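(* Let $s,t\ge 0$ be integers, $k=2^{s+t}$, and let $M$ be a smooth manifold with $\dim M\ge 2(s+t)$ equipped with an almost Cliffordian structure $A$ based on the Clifford algebra $\mathcal{C}l(s,t)$. Let $\nabla$ be a linear connection on $M$ with $\nabla A=0$. Let $[\nabla]$ be the class of all linear connections $\bar\nabla$ on $M$ that preserve $A$ (i.e. $\bar\nabla A=0$), have the same torsion as $\nabla$, and have the same $A$-planar curves as $\nabla$. Then there are signs $\epsilon_1,\dots,\epsilon_k\in\{\pm1\}$ (depending only on $\mathcal{C}l(s,t)$ and its chosen basis) such that $[\nabla]$ is isomorphic to $T^*M$ via $$\Upsilon\ \longmapsto\ \nabla+\sum_{i=1}^{k}\epsilon_i\,(\Upsilon\circ F_i)\odot F_i ,$$ where $\Upsilon$ is a one-form on $M$ and $F_1,\dots,F_k$ are (local) affinors forming the standard Clifford basis of $A$; that is, this map is a well-defined bijection from the one-forms on $M$ onto $[\nabla]$.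
   Context: The Clifford algebra $\mathcal O=\mathcal{C}l(s,t)$ is the real associative unital algebra of dimension $k=2^{s+t}$ generated by pairwise anticommuting elements $I_1,\dots,I_t$ with $I_i^2=-E$ and $J_1,\dots,J_s$ with $J_j^2=E$, where $E$ is the unit. Its standard basis $F_1,\dots,F_k$ consists of $F_1=E$, the generators $I_i$, $J_j$, and all products of two or more distinct generators (one for each subset of generators). An affinor is a $(1,1)$-tensor field. An $\ell$-dimensional $A$-structure on a manifold $M$ is a smooth rank-$\ell$ vector subbundle $A\subset T^*M\otimes TM$ with $\ell<\dim M$ such that the identity affinor $E=\mathrm{id}_{T_xM}$ belongs to $A_x$ for every $x\in M$. An almost Cliffordian manifold based on $\mathcal O$ is a manifold of dimension $km$, $m\in\mathbb N$, with an $A$-structure where $A$ is the Clifford algebra $\mathcal O$: locally $A=\langle F_1,\dots,F_k\rangle$ where $F_1=E,F_2,\dots,F_k$ are local affinors satisfying the relations of the standard basis of $\mathcal O$, and each $T_xM$ can be identified with $\mathcal O^m$ so that $A_x$ acts as $\mathcal O$ acting blockwise (i.e. $T_xM$ is a free module). Equivalently it is a reduction of the frame bundle to $GL(m,\mathcal O)GL(1,\mathcal O)$, the group generated by the linear automorphisms of $\mathbb R^{km}=\mathcal O^m$ commuting with all $F_i$ and by the invertible elements of $\langle F_1,\dots,F_k\rangle$. $\nabla A=0$ means that covariant differentiation preserves sections of the subbundle $A$. For $X\in T_xM$ put $A(X)=\{F(X): F\in A_x\}\subset T_xM$. A smooth curve $c:\mathbb R\to M$ is $A$-planar with respect to $\nabla$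 if $\nabla_{\dot c}\dot c\in A(\dot c)$. For a one-form $\alpha$ and an affinor $F$, $(\Upsilon\circ F)(X)=\Upsilon(F(X))$, and $(\Upsilon\circ F)\odot F$ is the symmetrized product: the symmetric bilinear map $(X,Y)\mapsto \Upsilon(FX)F(Y)+\Upsilon(FY)F(X)$. *)

(* Defs.v *)
From HB Require Import structures.
From mathcomp Require Import all_boot all_order all_algebra all_field.
From mathcomp Require Import all_classical all_reals all_analysis.

Set Implicit Arguments.
Unset Strict Implicit.
Unset Printing Implicit Defensive.

Import Order.TTheory GRing.Theory Num.Theory.
Import numFieldNormedType.Exports.

Local Open Scope classical_set_scope.
Local Open Scope ring_scope.

(* Differential geometry in local coordinates. A tensor field on M is the
   family of its component functions, indexed by a chart c and a point x of
   the domain of c, subject to the transformation law under changes of charts.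
   Tangent vectors are column vectors, so affinors act by F *m u and
   composition of affinors is the matrix product; one-forms are row vectors. *)

(* C^j on an open set U: iterated directional derivatives up to order j exist
   and are continuous on U. *)
Fixpoint Ck_on (R : realType) (V W : normedModType R) (j : nat)
    (U : set V) (f : V -> W) : Prop :=
  (forall x, U x -> {for x, continuous f}) /\
  (if j is j'.+1 then
     forall v, (forall x, U x -> derivable f x v) /\ Ck_on j' U ('D_v f)
   else True).

Definition smooth_on (R : realType) (V W : normedModType R)
    (U : set V) (f : V -> W) : Prop :=
  forall j, Ck_on j U f.

(* [cinv c] is only meaningful on the image of [cdom c] under [cmap c]. *)
Record manifold (R : realType) (n : nat) := Manifold {
  mpoint :> topologicalType ;
  chart : Type ;
  cdom : chart -> set mpoint ;
  cmap : chart -> mpoint -> 'cV[R]_n ;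
  cinv : chart -> 'cV[R]_n -> mpoint ;
  manifold_hausdorff : hausdorff_space mpoint ;
  manifold_second_countable : @second_countable mpoint ;
  cdom_cover : forall x, exists c, cdom c x ;
  cdom_open : forall c, open (cdom c) ;
  cimage_open : forall c, open (cmap c @` cdom c) ;
  cmapK : forall c x, cdom c x -> cinv c (cmap c x) = x ;
  cmap_continuous : forall c x, cdom c x -> {for x, continuous (cmap c)} ;
  cinv_continuous : forall c p, (cmap c @` cdom c) p ->
    {for p, continuous (cinv c)} ;
  transition_smooth : forall c d,
    smooth_on (cmap c @` (cdom c `&` cdom d)) (cmap d \o cinv c)
}.

Section Geometry.
Variables (R : realType) (n : nat) (M : manifold R n).

Definition transition (c d : chart M) : 'cV[R]_n -> 'cV[R]_n :=
  cmap d \o cinv c.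

(* Change of components, from c to d, of a tangent vector at x. *)
Definition dtrans (c d : chart M) (x : M) (u : 'cV[R]_n) : 'cV[R]_n :=
  'd (transition c d) (cmap c x) u.

Definition smooth_in (W : normedModType R) (c : chart M) (U : set M)
    (f : M -> W) : Prop :=
  smooth_on (cmap c @` U) (f \o cinv c).

Definition form_field := chart M -> M -> 'rV[R]_n.

Definition eval_form (al : 'rV[R]_n) (u : 'cV[R]_n) : R := (al *m u) 0 0.

(* Components outside the domain of a chart are set to 0, so that two
   one-forms are equal iff they are equal as families of functions. *)
Definition one_form : set form_field := [set Y |
  [/\ forall c x, ~ cdom c x -> Y c x = 0,
      forall c, smooth_in c (cdom c) (Y c) &
      forall c d x u, cdom c x -> cdom d x ->
        eval_form (Y c x) u = eval_form (Y d x) (dtrans c d x u)]].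

(* A linear connection, given by its connection matrices: in the chart c,
   nabla_u Y = D_u Y + om c x u *m Y, i.e. om c x u *m v = Gamma(u, v) with
   Gamma the Christoffel symbols. The last clause is their transformation law;
   components outside the domain of a chart are 0 as for one-forms. *)
Definition connection_field := chart M -> M -> 'cV[R]_n -> 'M[R]_n.

Definition connection : set connection_field := [set om |
  [/\ forall c x u, ~ cdom c x -> om c x u = 0,
      forall c x, cdom c x -> linear (om c x),
      forall c u, smooth_in c (cdom c) (fun x => om c x u) &
      forall c d x u v, cdom c x -> cdom d x ->
        dtrans c d x (om c x u *m v) =
          'D_u (fun p => 'D_v (transition c d) p) (cmap c x)
          + om d x (dtrans c d x u) *m dtrans c d x v]].

(* Components of T(X, Y) = nabla_X Y - nabla_Y X - [X, Y] on coordinate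
   fields, whose bracket vanishes. *)
Definition torsion (om : connection_field) (c : chart M) (x : M)
    (u v : 'cV[R]_n) : 'cV[R]_n :=
  om c x u *m v - om c x v *m u.

(* Covariant derivative at x, in the direction u, of the affinor with
   components F in the chart c. *)
Definition cov_affinor (om : connection_field) (c : chart M) (F : M -> 'M[R]_n)
    (x : M) (u : 'cV[R]_n) : 'M[R]_n :=
  'D_u (F \o cinv c) (cmap c x) + om c x u *m F x - F x *m om c x u.

Definition affinor_bundle := chart M -> M -> {vspace 'M[R]_n}.

Definition A_structure (l : nat) (A : affinor_bundle) : Prop :=
  [/\ (l < n)%N,
      forall c x, cdom c x -> 1%:M \in A c x,
      forall c d x (F G : 'M[R]_n), cdom c x -> cdom d x ->
        (forall u, dtrans c d x (F *m u) = G *m dtrans c d x u) ->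
        (F \in A c x) = (G \in A d x) &
      forall c x, cdom c x ->
        exists (W : set M) (F : 'I_l -> M -> 'M[R]_n),
        [/\ open W, W x, W `<=` cdom c,
            forall i, smooth_in c W (F i) &
            forall y, W y -> basis_of (A c y) [seq F i y | i <- enum 'I_l]]].

Definition preserves (A : affinor_bundle) (om : connection_field) : Prop :=
  forall (c : chart M) (W : set M) (F : M -> 'M[R]_n),
    open W -> W `<=` cdom c -> smooth_in c W F ->
    (forall y, W y -> F y \in A c y) ->
    forall x u, W x -> cov_affinor om c F x u \in A c x.

Definition A_span (A : affinor_bundle) (c : chart M) (x : M) (u : 'cV[R]_n) :
    set 'cV[R]_n :=
  [set F *m u | F in [set F : 'M[R]_n | F \in A c x]].

Definition smooth_curve (gam : R -> M) : Prop :=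
  continuous gam /\
  forall c, @smooth_on R R^o 'cV[R]_n (gam @^-1` cdom c) (cmap c \o gam).

Definition A_planar (A : affinor_bundle) (om : connection_field)
    (gam : R -> M) : Prop :=
  smooth_curve gam /\
  forall (c : chart M) (r : R), cdom c (gam r) ->
    let q : R -> 'cV[R]_n := cmap c \o gam in
    A_span A c (gam r) (derive1 q r)
      (derive1n 2 q r + om c (gam r) (derive1 q r) *m derive1 q r).

Definition planar_class (A : affinor_bundle) (om : connection_field) :
    set connection_field :=
  [set om' |
    [/\ connection om', preserves A om',
        forall c x u v, cdom c x -> torsion om' c x u v = torsion om c x u v &
        forall gam : R -> M, A_planar A om' gam <-> A_planar A om gam]].

Definition odot (be : 'rV[R]_n) (F : 'M[R]_n) (u v : 'cV[R]_n) : 'cV[R]_n :=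
  eval_form be u *: (F *m v) + eval_form be v *: (F *m u).

End Geometry.

(* Generators g_i with i < s play the role of the J's (square 1), the
   remaining t ones that of the I's (square -1). *)
Definition clifford_gens (B : pzRingType) (s t : nat) (g : 'I_(s + t) -> B) :
    Prop :=
  (forall i, g i * g i = if (i < s)%N then 1 else -1) /\
  (forall i j, i != j -> g i * g j = - (g j * g i)).

(* The factors are taken in increasing order of the indices; the empty set
   gives the unit. *)
Definition std_basis (B : pzRingType) (k : nat) (g : 'I_k -> B)
    (X : {set 'I_k}) : B :=
  \prod_(i in X) g i.

Record clifford_algebra (R : realType) (s t : nat) := CliffordAlgebra {
  cl_alg :> falgType R ;
  cl_gen : 'I_(s + t) -> cl_alg ;
  cl_genP : @clifford_gens cl_alg s t cl_gen ;
  cl_generated :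
    agenv <<[seq cl_gen i | i <- enum 'I_(s + t)]>>%VS = fullv ;
  cl_dim : \dim (@fullv R cl_alg) = (2 ^ (s + t))%N
}.

(* Over W, the local affinors std_basis (g^~ y) X, with X a subset of
   'I_(s + t), form a standard Clifford basis of A. *)
Definition clifford_frame (R : realType) (n s t : nat) (M : manifold R n)
    (A : affinor_bundle M) (c : chart M) (W : set M)
    (g : 'I_(s + t) -> M -> 'M[R]_n) : Prop :=
  [/\ open W, W `<=` cdom c,
      forall i, smooth_in c W (g i) &
      forall y, W y ->
        @clifford_gens 'M[R]_n s t (g ^~ y) /\
        A c y = <<[seq std_basis (g ^~ y) X | X <- enum {set 'I_(s + t)}]>>%VS].

(* theta identifies the tangent space at y with O^m. *)
Definition almost_cliffordian (R : realType) (s t m : nat)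
    (O : clifford_algebra R s t) (M : manifold R (2 ^ (s + t) * m))
    (A : affinor_bundle M) : Prop :=
  A_structure (2 ^ (s + t)) A /\
  forall c x, cdom c x ->
    exists (W : set M) (g : 'I_(s + t) -> M -> 'M[R]_(2 ^ (s + t) * m)),
    [/\ W x, clifford_frame A c W g &
        forall y, W y ->
          exists theta : {linear 'cV[R]_(2 ^ (s + t) * m) -> {ffun 'I_m -> O}},
            bijective theta /\
            forall X v a, theta (std_basis (g ^~ y) X *m v) a
                          = std_basis (@cl_gen R s t O) X * theta v a].

(* Main.v *)
Require Import Defs.
From HB Require Import structures.
From mathcomp Require Import all_boot all_order all_algebra all_field.
From mathcomp Require Import all_classical all_reals all_analysis.
From mathcomp Require Import ring lra.

Set Implicit Arguments.
Unset Strict Implicit.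
Unset Printing Implicit Defensive.

Import Order.TTheory GRing.Theory Num.Theory.
Import numFieldNormedType.Exports.

Local Open Scope classical_set_scope.
Local Open Scope ring_scope.

(**
Write F_X for the product of the generators in X, and eps_X for the sign of
F_X^2, so that F_X^-1 = eps_X F_X. The tensor sum_X F_X (x) F_X^-1 is a
Casimir element: multiplying it by an element of the Clifford algebra on the
left of the first factor or on the right of the second one gives the same
result. Hence sum_X eps_X (Upsilon o F_X) odot F_X does not depend on the
Clifford frame, and adding it to a connection preserves A; its trace is
(dim M + 2^(s+t)) Upsilon, which gives injectivity.

Conversely let P be the difference of two connections of the class. It is
symmetric, [P(u), A] is contained in A since both connections preserve A, and
P(u)u lies in A(u): this is seen on a geodesic with initial velocity u,
which is A-planar for one connection and hence for the other. Split
P(u) = a(u) + C(u) with a(u) in A and C(u) commuting with A, C(u) being the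
average of P(u) under the Casimir element. Comparing coordinates with respect
to a basis of the tangent space over the Clifford algebra (of rank at least 2)
yields P(u)v = p(u)v + p(v)u with p linear over the algebra, and Upsilon is
the coefficient of the unit in p.
*)

(** * Functions of class C^k *)

Section CkOn.
Variables (R : realType) (V : normedModType R).
Implicit Types (U : set V).

(** Smoothness is given one direction at a time, by iterated directional derivatives, and planarity
    only tests curves defined on the whole line. Producing a planar curve with a prescribed velocity
    therefore requires differentiability of C^1 maps, the chain rule and a local existence theorem
    for differential equations.

    The rank m over the Clifford algebra O is at least 2 because an A-structure has rank 2^(s+t)
    smaller than dim M = 2^(s+t) m. The algebraic obstacle is that O is in general neither
    commutative nor free of zero divisors, so coefficients cannot be cancelled. The ones in the way
    are shown to be central, or are killed by comparing terms of different degree.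

    The signs come from the last step. The product F_X F_Z has a unit component only for Z = X;
    hence the coefficient of F_X in p(u) is eps_X times the unit coefficient of F_X p(u) = p(F_X u),
    that is eps_X Upsilon(F_X u), and p(u)v + p(v)u is the sum in the theorem. *)

Lemma Ck_on_pointwise (W : normedModType R) j U (f : V -> W) :
  Ck_on j U f <-> forall x, U x -> Ck_on j [set x] f.
Proof.
elim: j f => [|j IH] f /=; split.
- by move=> [cf _] x Ux; split=> // y ->; exact: cf.
- by move=> h; split=> // x Ux; apply: (proj1 (h x Ux)).
- move=> [cf df] x Ux; split; first by move=> y ->; exact: cf.
  move=> v; have [d1 d2] := df v; split; first by move=> y ->; exact: d1.
  by apply: (proj1 (IH _) d2).
- move=> h; split; first by move=> x Ux; apply: (proj1 (h x Ux)).
  move=> v; split; first by move=> x Ux; apply: (proj1 (proj2 (h x Ux) v)).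
  by apply/IH => x Ux; apply: (proj2 (proj2 (h x Ux) v)).
Qed.

Lemma Ck_on_sub (W : normedModType R) j U U' (f : V -> W) :
  U' `<=` U -> Ck_on j U f -> Ck_on j U' f.
Proof. by move=> s /Ck_on_pointwise h; apply/Ck_on_pointwise => x /s/h. Qed.

Lemma Ck_on_near (W : normedModType R) j x (f g : V -> W) :
  {near x, f =1 g} -> Ck_on j [set x] f -> Ck_on j [set x] g.
Proof.
have cnear (f' g' : V -> W) : {near x, f' =1 g'} ->
    {for x, continuous f'} -> {for x, continuous g'}.
  move=> fg cf; suff : g' @ x --> g' x by []; rewrite -(nbhs_singleton fg).
  exact: cvg_trans (near_eq_cvg fg) cf.
elim: j f g => [|j IH] f g fg /= [cf df]; split=> //.
- by move=> y ->; apply: cnear fg (cf x _).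
- by move=> y ->; apply: cnear fg (cf x _).
- move=> v; have [d1 d2] := df v; split.
    by move=> y ->; apply: near_eq_derivable fg (d1 x _).
  apply: IH d2.
  (* Equality near x is equality near every point close to x, so the directional derivatives also
     agree near x. *)
  move: fg => /near_join; apply: filterS => y.
  by move/(near_eq_derive v).
Qed.

Lemma Ck_on_eq (W : normedModType R) j U (f g : V -> W) :
  open U -> (forall x, U x -> f x = g x) -> Ck_on j U f -> Ck_on j U g.
Proof.
move=> oU fg /Ck_on_pointwise h; apply/Ck_on_pointwise => x Ux.
by apply: Ck_on_near (h x Ux); apply: filterS fg _; apply: open_nbhs_nbhs.
Qed.

Lemma Ck_on_cont (W : normedModType R) j U (f : V -> W) x :
  Ck_on j U f -> U x -> {for x, continuous f}.
Proof. by case: j => [|j] [cf _]; exact: cf. Qed.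

Lemma Ck_on_pred (W : normedModType R) j U (f : V -> W) :
  Ck_on j.+1 U f -> Ck_on j U f.
Proof.
elim: j f => [|j IH] f [cf df]; split=> // v.
by have [d1 d2] := df v; split=> //; apply: IH.
Qed.

Lemma Ck_on_derive (W : normedModType R) j U (f : V -> W) v :
  Ck_on j.+1 U f -> Ck_on j U ('D_v f).
Proof. by move=> [_ /(_ v) []]. Qed.

Lemma Ck_on_derivable (W : normedModType R) j U (f : V -> W) v x :
  Ck_on j.+1 U f -> U x -> derivable f x v.
Proof. by move=> [_ /(_ v) [d _]]; exact: d. Qed.

Lemma Ck_on_cst (W : normedModType R) j U (a : W) : Ck_on j U (fun=> a).
Proof.
elim: j a => [|j IH] a /=; split=> //.
- by move=> x _; exact: cst_continuous.
- by move=> x _; exact: cst_continuous.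
- move=> v; split; first by move=> x _; exact: derivable_cst.
  by have -> : 'D_v (fun=> a) = (fun=> 0) :> (V -> W);
    [apply/funext => x; exact: derive_cst|exact: IH].
Qed.

Lemma Ck_on_id j U : open U -> Ck_on j U (fun x : V => x).
Proof.
move=> oU; case: j => [|j].
  by split; last by []; move=> t _; exact: cvg_id.
split; first by move=> t _; exact: cvg_id.
move=> v; split; first by move=> t _; exact: derivable_id.
apply: (@Ck_on_eq _ _ _ (fun=> v)) => //; last exact: Ck_on_cst.
by move=> t _; rewrite derive_id.
Qed.

Lemma Ck_onD (W : normedModType R) j U (f g : V -> W) : open U ->
  Ck_on j U f -> Ck_on j U g -> Ck_on j U (fun x => f x + g x).
Proof.
move=> oU; elim: j f g => [|j IH] f g [cf df] [cg dg] /=; split=> //.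
- by move=> x Ux; apply: continuousD; [exact: cf|exact: cg].
- by move=> x Ux; apply: continuousD; [exact: cf|exact: cg].
- move=> v; have [d1 d2] := df v; have [e1 e2] := dg v; split.
    by move=> x Ux; apply: derivableD; [exact: d1|exact: e1].
  apply: (Ck_on_eq oU _ (IH _ _ d2 e2)) => x Ux.
  by rewrite [RHS]deriveD //; [exact: d1|exact: e1].
Qed.

Lemma Ck_on_sum (W : normedModType R) (I : Type) (r : seq I) (P : pred I) j U
    (f : I -> V -> W) : open U -> (forall i, P i -> Ck_on j U (f i)) ->
  Ck_on j U (fun x => \sum_(i <- r | P i) f i x).
Proof.
move=> oU h; elim: r => [|i r IH].
  apply: (Ck_on_eq oU _ (Ck_on_cst j U 0)) => x _.
  by rewrite big_nil.
case Pi: (P i).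
  apply: (Ck_on_eq oU _ (Ck_onD oU (h i Pi) IH)) => x _.
  by rewrite big_cons Pi.
by apply: (Ck_on_eq oU _ IH) => x _; rewrite big_cons Pi.
Qed.

Lemma Ck_onM j U (f g : V -> R) : open U ->
  Ck_on j U f -> Ck_on j U g -> Ck_on j U (fun x => f x * g x).
Proof.
move=> oU; elim: j f g => [|j IH] f g hf hg.
  have [[cf _] [cg _]] := (hf, hg).
  by split=> // x Ux; apply: continuousM; [exact: cf|exact: cg].
have [[cf df] [cg dg]] := (hf, hg); split.
  by move=> x Ux; apply: continuousM; [exact: cf|exact: cg].
move=> v; have [d1 d2] := df v; have [e1 e2] := dg v; split.
  by move=> x Ux; apply: derivableM; [exact: d1|exact: e1].
have := Ck_onD oU (IH _ _ (Ck_on_pred hf) e2) (IH _ _ (Ck_on_pred hg) d2).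
by apply: (Ck_on_eq oU) => x Ux; rewrite [RHS]deriveM //; [exact: d1|exact: e1].
Qed.

Lemma derivable_lin (W W' : normedModType R) (L : {linear W -> W'})
    (f : V -> W) x v : continuous L -> derivable f x v ->
  derivable (L \o f) x v /\ 'D_v (L \o f) x = L ('D_v f x).
Proof.
move=> cL df.
have h : (fun h : R => h^-1 *: ((L \o f \o shift x) (h *: v) - (L \o f) x)) @ 0^'
    --> L ('D_v f x).
  have -> : (fun h : R => h^-1 *: ((L \o f \o shift x) (h *: v) - (L \o f) x)) =
     L \o (fun h : R => h^-1 *: ((f \o shift x) (h *: v) - f x)).
    by apply/funext => h /=; rewrite linearZ_LR (linearB L).
  by apply: cvg_comp; [exact: df|exact: cL].
by split; [apply/cvg_ex; exists (L ('D_v f x))|apply: cvg_lim].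
Qed.

Lemma Ck_on_lin (W W' : normedModType R) (L : {linear W -> W'}) j U
    (f : V -> W) : open U -> continuous L -> Ck_on j U f -> Ck_on j U (L \o f).
Proof.
move=> oU cL; elim: j f => [|j IH] f [cf df] /=; split=> //.
- by move=> x Ux; apply: continuous_comp; [exact: cf|exact: cL].
- by move=> x Ux; apply: continuous_comp; [exact: cf|exact: cL].
- move=> v; have [d1 d2] := df v; split.
    by move=> x Ux; apply: (derivable_lin cL (d1 x Ux)).1.
  apply: (Ck_on_eq oU _ (IH _ d2)) => x Ux.
  by rewrite (derivable_lin cL (d1 x Ux)).2.
Qed.

Lemma continuous_mx m n (f : V -> 'M[R]_(m, n)) x :
  (forall i k, {for x, continuous (fun y => f y i k)}) -> {for x, continuous f}.
Proof.
move=> h; apply/cvgrPdist_le => e e0; near=> y.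
rewrite /Num.Def.normr/= mx_normrE (bigmax_le _ (ltW e0))//= => i _.
rewrite !mxE/=.
move: i; near: y; apply: filter_forall => /= i.
exact: ((cvgrPdist_le _ _).1 (h i.1 i.2)).
Unshelve. all: by end_near. Qed.

Lemma Ck_on_mx m n j U (f : V -> 'M[R]_(m, n)) : open U ->
  (forall i k, Ck_on j U (fun x => f x i k)) <-> Ck_on j U f.
Proof.
move=> oU; split; last first.
  move=> h i k; elim: j f h => [|j IH] f [cf df]; split=> //.
  - move=> x Ux; apply: (@continuous_comp _ _ _ f (fun M => M i k)) => //.
      exact: cf.
    exact: coord_continuous.
  - move=> x Ux; apply: (@continuous_comp _ _ _ f (fun M => M i k)) => //.
      exact: cf.
    exact: coord_continuous.
  - move=> v; have [d1 d2] := df v; split.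
      by move=> x Ux; move: (d1 x Ux) => /derivable_mxP.
    apply: (Ck_on_eq oU _ (IH _ d2)) => x Ux.
    by rewrite derive_mx ?mxE //; exact: d1.
elim: j f => [|j IH] f h; split=> //.
- by move=> x Ux; apply: continuous_mx => i k; exact: Ck_on_cont (h i k) Ux.
- by move=> x Ux; apply: continuous_mx => i k; exact: Ck_on_cont (h i k) Ux.
- have df x v : U x -> derivable f x v.
    move=> Ux; apply/derivable_mxP => i k; exact: Ck_on_derivable (h i k) Ux.
  move=> v; split; first by move=> x Ux; exact: df.
  apply: IH => i k; apply: (Ck_on_eq oU _ (Ck_on_derive v (h i k))) => x Ux.
  by rewrite derive_mx ?mxE //; exact: df.
Qed.

Lemma Ck_on_mul m n p j U (f : V -> 'M[R]_(m, n)) (g : V -> 'M[R]_(n, p)) :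
  open U -> Ck_on j U f -> Ck_on j U g -> Ck_on j U (fun x => f x *m g x).
Proof.
move=> oU /(Ck_on_mx _ _ oU) hf /(Ck_on_mx _ _ oU) hg.
apply/(Ck_on_mx _ _ oU) => i k.
apply: (@Ck_on_eq _ _ _ (fun x => \sum_l f x i l * g x l k)) => //.
  by move=> x _; rewrite mxE.
by apply: Ck_on_sum => // l _; apply: Ck_onM.
Qed.

Lemma Ck_onZ m n j U (s : V -> R) (f : V -> 'M[R]_(m, n)) :
  open U -> Ck_on j U s -> Ck_on j U f -> Ck_on j U (fun x => s x *: f x).
Proof.
move=> oU hs /(Ck_on_mx _ _ oU) hf; apply/(Ck_on_mx _ _ oU) => i k.
apply: (@Ck_on_eq _ _ _ (fun x => s x * f x i k)) => //.
  by move=> x _; rewrite mxE.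
exact: Ck_onM.
Qed.

End CkOn.

(** * Mean value theorem and differentiability of C^1 maps *)

Section MeanValue.
Variables (R : realType) (V : normedModType R).

Lemma derive_line (W : normedModType R) (f : V -> W) y v (s : R) :
  derivable f (s *: v + y) v ->
  is_derive s 1 (fun r : R => f (r *: v + y)) ('D_v f (s *: v + y)).
Proof.
move=> df.
have e : (fun h : R => h^-1 *: (((fun r : R => f (r *: v + y)) \o shift s) (h *: (1 : R))
      - f (s *: v + y))) =
    (fun h : R => h^-1 *: ((f \o shift (s *: v + y)) (h *: v) - f (s *: v + y))).
  apply/funext => h /=; congr (_ *: (f _ - _)).
  by rewrite addrA -scalerDl /GRing.scale /= mulr1.
by split; rewrite /derivable /derive e.
Qed.

Lemma mean_value (f : V -> R) y v :
  (forall s : R, 0 <= s <= 1 -> derivable f (s *: v + y) v) ->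
  exists2 c : R, 0 <= c <= 1 & f (v + y) - f y = 'D_v f (c *: v + y).
Proof.
move=> df.
have h (s : R) : s \in `[0, 1]%R ->
    is_derive s 1 (fun r : R => f (r *: v + y)) ('D_v f (s *: v + y)).
  by rewrite in_itv /= => sI; apply: derive_line; exact: df.
have ct : {within `[0, 1], continuous (fun r : R => f (r *: v + y))}.
  by apply: derivable_within_continuous => s /h [].
have [c cI E] := @MVT_segment R (fun r : R => f (r *: v + y))
    (fun s => 'D_v f (s *: v + y)) 0 1 ler01 (fun s sI => h s (subset_itv_oo_cc sI)) ct.
exists c; first by move: cI; rewrite in_itv.
by move: E; rewrite scale1r scale0r add0r subr0 mulr1.
Qed.

End MeanValue.

Section C1.
Variables (R : realType) (V : normedModType R).

Lemma derive_scalev (W : normedModType R) (f : V -> W) y v (h : R) :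
  derivable f y v -> derivable f y (h *: v) /\ 'D_(h *: v) f y = h *: 'D_v f y.
Proof.
move=> df; have [->|h0] := eqVneq h 0.
  by rewrite !scale0r derive0; split=> //; exact: derivable0.
have : (fun t : R => t^-1 *: ((f \o shift y) (t *: (h *: v)) - f y)) @ 0^' -->
    h *: 'D_v f y.
  have -> : (fun t : R => t^-1 *: ((f \o shift y) (t *: (h *: v)) - f y)) =
     (fun t : R => h *: (t^-1 *: ((f \o shift y) (t *: v) - f y))) \o (fun t : R => t * h).
    apply/funext => t /=; rewrite !scalerA; congr (_ *: _).
    by have [->|t0] := eqVneq t 0; rewrite ?mul0r ?invr0 ?mulr0 // invfM mulrCA divff // mulr1.
  (* As h is nonzero, t * h tends to 0 without reaching it; this is why h = 0 is treated apart. *)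
  apply: (@cvg_comp _ _ _ (fun t : R => t * h) _ (0^') (0^')) => /=.
    move=> A; rewrite /dnbhs /within /= -!nbhs_nearE => /nbhs_ballP [e e0 eA].
    apply/nbhs_ballP; exists (e / `|h|) => /=; first by rewrite divr_gt0 // normr_gt0.
    move=> t; rewrite /ball /= !sub0r !normrN => te t0.
    apply: eA; last by rewrite mulf_neq0.
    by rewrite /ball /= sub0r normrN normrM -ltr_pdivlMr ?normr_gt0.
  apply: (@cvg_comp _ _ _ _ (fun w => h *: w) _ (nbhs ('D_v f y)) _ df).
  exact: scaler_continuous.
move=> cv; split; first by apply/cvg_ex; exists (h *: 'D_v f y).
exact: cvg_lim.
Qed.

Variables (U : set V).
Hypothesis oU : open U.

(* By the mean value theorem along v, f(y + hu + hv) - f(y + hu) is h times a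
   value of D_v f near y: continuity of D_v f alone makes the derivative
   additive, and this is what turns C^1 into Frechet differentiability. *)
Lemma derive_addv_real (f : V -> R) u v y :
  (forall w x, U x -> derivable f x w) ->
  {for y, continuous ('D_v f)} ->
  U y -> 'D_(u + v) f y = 'D_u f y + 'D_v f y.
Proof.
move=> df cv Uy; apply/eqP; rewrite -subr_eq0 -normr_le0.
apply/ler_addgt0Pl => e e0; rewrite addr0.
have e3 : 0 < e / 3 by rewrite divr_gt0.
have Duv := (cvgrPdist_le _ _).1 (df (u + v) y Uy) _ e3.
have Du := (cvgrPdist_le _ _).1 (df u y Uy) _ e3.
have Dv := (cvgrPdist_le _ _).1 cv _ e3.
have cont2 : {for (0 : R, 0 : R), continuous (fun p : R * R => p.1 *: u + p.2 *: v + y)}.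
  apply: cvgD; last exact: cvg_cst.
  apply: cvgD; apply: cvgZr_tmp; [exact: cvg_fst|exact: cvg_snd].
have y0 : (fun p : R * R => p.1 *: u + p.2 *: v + y) (0, 0) = y.
  by rewrite /= !scale0r !add0r.
rewrite /prop_for /continuous_at y0 in cont2.
have /nbhs_ballP [d d0 dP] : \forall p \near (0 : R, 0 : R),
    `|'D_v f y - 'D_v f (p.1 *: u + p.2 *: v + y)| <= e / 3 /\ U (p.1 *: u + p.2 *: v + y).
  apply: cont2 (fun z => `|'D_v f y - 'D_v f z| <= e / 3 /\ U z) _.
  by apply: filterI; [exact: Dv|apply: open_nbhs_nbhs].
near (0 : R)^' => h.
have h0 : h != 0 by near: h; exact: nbhs_dnbhs_neq.
have hd : `|h| < d by near: h; exact: dnbhs0_lt.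
have hU (s : R) : 0 <= s <= 1 ->
   `|'D_v f y - 'D_v f (s *: (h *: v) + (h *: u + y))| <= e / 3 /\ U (s *: (h *: v) + (h *: u + y)).
  move=> /andP[s0 s1]; have := dP (h, s * h).
  rewrite /= scalerA addrA [_ *: v + _]addrC; apply.
  split; rewrite /ball /= sub0r normrN //.
  by rewrite normrM ger0_norm // (le_lt_trans _ hd) // ler_piMl.
have [s sI|c cI E] := @mean_value R V f (h *: u + y) (h *: v).
  by apply: df; exact: (hU s sI).2.
have [hc1 hc2] := hU c cI.
rewrite (derive_scalev h (df v _ hc2)).2 in E.
have Huv : `|'D_(u + v) f y - h^-1 *: (f (h *: (u + v) + y) - f y)| <= e / 3.
  by near: h; exact: (Duv _).
have Hu : `|'D_u f y - h^-1 *: (f (h *: u + y) - f y)| <= e / 3.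
  by near: h; exact: (Du _).
have F : h^-1 *: (f (h *: (u + v) + y) - f y) = h^-1 *: (f (h *: u + y) - f y) +
    'D_v f (c *: (h *: v) + (h *: u + y)).
  have -> : f (h *: (u + v) + y) = f (h *: v + (h *: u + y)).
    by rewrite scalerDr addrCA addrA.
  have {}E : f (h *: v + (h *: u + y)) - f (h *: u + y) =
    h * 'D_v f (c *: (h *: v) + (h *: u + y)) := E.
  rewrite -[X in _ = _ + X](mulKf h0) -E /GRing.scale /= -mulrDr.
  by congr (_ * _); rewrite [RHS]addrC subrKA.
rewrite F in Huv; move: Huv Hu hc1.
move: ('D_(u + v) f y) ('D_u f y) ('D_v f y) (h^-1 *: (f (h *: u + y) - f y)) ('D_v f _).
move=> a b b' p q; rewrite !ler_norml => /andP[? ?] /andP[? ?] /andP[? ?].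
by apply/andP; split; lra.
Unshelve. all: by end_near. Qed.

Lemma derive_addv m n (f : V -> 'M[R]_(m, n)) u v y :
  (forall w x, U x -> derivable f x w) ->
  {for y, continuous ('D_v f)} ->
  U y -> 'D_(u + v) f y = 'D_u f y + 'D_v f y.
Proof.
move=> df cv Uy; rewrite !derive_mx; try exact: df.
apply/matrixP => i k; rewrite !mxE.
apply: derive_addv_real => //.
  by move=> w x Ux; move: (df w x Ux) => /derivable_mxP.
have h : {for y, continuous (fun x => ('D_v f x) i k)}.
  by apply: (@continuous_comp _ _ _ ('D_v f) (fun M => M i k)) => //; exact: coord_continuous.
have e : {near y, (fun x => ('D_v f x) i k) =1 'D_v (fun x => f x i k)}.
  apply: filterS (open_nbhs_nbhs (conj oU Uy)) => x Ux /=.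
  by rewrite (derive_mx (df v x Ux)) mxE.
suff : 'D_v (fun x => f x i k) @ y --> 'D_v (fun x => f x i k) y by [].
rewrite -(nbhs_singleton e); exact: cvg_trans (near_eq_cvg e) h.
Qed.

End C1.

Lemma mx_norm_ge (R : realDomainType) m n (A : 'M[R]_(m, n)) i j :
  `|A i j| <= `|A|.
Proof.
rewrite [leRHS]/Num.Def.normr/= mx_normrE.
exact: (le_bigmax _ (fun k : 'I_m * 'I_n => `|A k.1 k.2|) (i, j)).
Qed.

Lemma mx_norm_le (R : realDomainType) m n (A : 'M[R]_(m, n)) (c : R) :
  0 <= c -> (forall i j, `|A i j| <= c) -> `|A| <= c.
Proof.
move=> c0 h; rewrite [leLHS]/Num.Def.normr/= mx_normrE.
by apply: bigmax_le => // -[i j] _; exact: h.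
Qed.

(** Covers both the real line and column vectors, so that differentiability and the chain rule are
    proved once for maps out of either. *)
Definition coordinate_system (R : realType) (V : normedModType R) (I : finType)
    (e : I -> V) (x : I -> {linear V -> R}) : Prop :=
  (forall i, continuous (x i)) /\ forall v, v = \sum_i x i v *: e i.

Section Composition.
Variables (R : realType) (V : normedModType R) (I : finType).
Variables (e : I -> V) (x : I -> {linear V -> R}).
Hypothesis ex : coordinate_system e x.

Lemma differentiable_from_linear (W : normedModType R) (f : V -> W) y (L : {linear V -> W}) :
  continuous L ->
  (forall eps : R, 0 < eps -> \forall h \near 0, `|f (h + y) - f y - L h| <= eps * `|h|) ->
  differentiable f y.
Proof.
move=> cL h.
have E : f \o shift y = cst (f y) + L +o_ 0 id.
  apply/eqaddoP => eps e0.
  by apply: filterS (h eps e0) => z; rewrite /= !fctE opprD addrA.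
by apply/diff_locallyP; rewrite (diff_unique cL E).
Qed.

Variables (U : set V).
Hypothesis oU : open U.

Lemma derive_coord m n (f : V -> 'M[R]_(m, n)) v y : Ck_on 1 U f -> U y ->
  'D_v f y = \sum_i x i v *: 'D_(e i) f y.
Proof.
move=> Cf Uy.
have df w z : U z -> derivable f z w by move=> Uz; exact: Ck_on_derivable Cf Uz.
have cf w : {for y, continuous ('D_w f)}.
  exact: Ck_on_cont (Ck_on_derive w Cf) Uy.
rewrite {1}(ex.2 v); elim: (index_enum I) => [|i r IH].
  by rewrite !big_nil derive0.
by rewrite !big_cons (derive_addv oU) // IH (derive_scalev _ (df _ _ Uy)).2.
Qed.

(** The candidate differential is built from the partial derivatives at y. By the mean value
    theorem, each entry of the increment along h is a derivative along h at an intermediate point;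
    expanding it in the same coordinates leaves only differences of partial derivatives, which are
    small by continuity. *)
Lemma C1_differentiable m n (f : V -> 'M[R]_(m, n)) y : Ck_on 1 U f -> U y ->
  differentiable f y.
Proof.
move=> Cf Uy.
pose L0 (v : V) := \sum_i x i v *: 'D_(e i) f y.
have lL : linear L0.
  move=> a u v; rewrite /L0 scaler_sumr -big_split; apply: eq_bigr => i _.
  by rewrite linearP /= scalerDl scalerA.
pose L : {linear V -> 'M[R]_(m, n)} := HB.pack L0 (GRing.isLinear.Build _ _ _ _ L0 lL).
have [K hK] : {K : I -> R & forall i, 0 < K i /\ forall v, `|x i v| <= K i * `|v|}.
  apply: (@choice _ _ (fun i k => 0 < k /\ forall v, `|x i v| <= k * `|v|)) => i.
  have [k k0 h] := linear_lipschitz (ex.1 i).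
  by exists k.
have [k k0 kx] : exists2 k : R, 0 < k & forall i v, `|x i v| <= k * `|v|.
  (* The 1 keeps the common bound positive when [I] is empty, as does the one in [d] below. *)
  exists (1 + \sum_i K i).
    by rewrite ltr_wpDr // sumr_ge0 // => i _; apply: ltW; exact: (hK i).1.
  move=> i v; apply: le_trans ((hK i).2 v) _.
  apply: ler_wpM2r => //; rewrite (bigD1 i) //= addrCA lerDl addr_ge0 // sumr_ge0 // => l _.
  by apply: ltW; exact: (hK l).1.
have cL : continuous L.
  move=> v; have : Ck_on 0 setT L0.
    apply: Ck_on_sum => [|i _]; first exact: openT.
    split; last by [].
    move=> z _; apply: (@continuous_comp _ _ _ (x i) (fun r : R => r *: 'D_(e i) f y)).
      exact: (ex.1 i).
    exact: scalel_continuous.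
  by move=> h; exact: (Ck_on_cont h).
apply: (@differentiable_from_linear _ f y L cL) => eps e0.
pose d := eps / (k * (#|I|%:R + 1)).
have d0 : 0 < d by rewrite divr_gt0 // mulr_gt0 // ltr_wpDl.
have : \forall z \near y, U z /\ forall i : I, `|'D_(e i) f y - 'D_(e i) f z| <= d.
  apply: filterI; first exact: open_nbhs_nbhs.
  apply: filter_forall => i.
  apply: (cvgrPdist_le _ _).1 d d0.
  exact: (Ck_on_cont (Ck_on_derive (e i) Cf) Uy).
move=> /nbhs_ballP [r r0 rP]; apply/nbhs_ballP; exists r => // h.
rewrite -ball_normE /= sub0r normrN => hr.
have hP (s : R) : 0 <= s <= 1 -> ball y r (s *: h + y).
  move=> /andP[s0 s1]; rewrite -ball_normE /= distrC addrK normrZ ger0_norm //.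
  by rewrite (le_lt_trans _ hr) // ler_piMl.
apply: mx_norm_le => [|i j]; first by rewrite mulr_ge0 // ltW.
rewrite !mxE /=.
have [s sI|c cI E] := @mean_value R V (fun z => f z i j) y h.
  have [Us _] := rP _ (hP s sI).
  by have /derivable_mxP := @Ck_on_derivable _ _ _ _ _ _ h _ Cf Us.
have [Uc hc] := rP _ (hP c cI).
rewrite E.
have -> : 'D_h (fun z => f z i j) (c *: h + y) = ('D_h f (c *: h + y)) i j.
  by rewrite derive_mx ?mxE //; exact: Ck_on_derivable Cf Uc.
rewrite (derive_coord h Cf Uc) /L0 !summxE -sumrB.
apply: le_trans (ler_norm_sum _ _ _) _.
apply: (@le_trans _ _ (\sum_(l : I) k * `|h| * d)).
  apply: ler_sum => l _; rewrite !mxE -mulrBr normrM.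
  apply: ler_pM => //.
  apply: le_trans (hc l); rewrite distrC; apply: le_trans (mx_norm_ge _ i j).
  by rewrite !mxE.
rewrite sumr_const -mulr_natl /d.
have N0 : (0 : R) <= #|I|%:R by [].
move: (#|I|%:R : R) N0 => N N0.
rewrite (_ : N * _ = eps * `|h| * (N / (N + 1))).
  by rewrite ler_piMr ?mulr_ge0 // ?ltW // ltr_pdivrMr ?ltr_wpDl // mul1r ltrDl.
have N1 : N + 1 != 0 by rewrite gt_eqF // ltr_wpDl.
by field; rewrite N1 gt_eqF.
Qed.

End Composition.

(** * Chain rule and composition of C^k maps *)

Section ChainRule.
Variables (R : realType) (T V W : normedModType R).

Lemma derive_line0 (S : normedModType R) (g : T -> S) t v :
  'D_v g t = 'D_1 (fun r : R => g (r *: v + t)) 0.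
Proof.
rewrite /derive; set a := (X in lim (X @ _)); set b := (X in _ = lim (X @ _)).
suff -> : a = b by []; apply/funext => h; rewrite /a /b /=.
by rewrite addr0 scale0r add0r /GRing.scale /= mulr1.
Qed.

(** Restricting [q] to the line through t reduces the claim to one real variable, where derivable
    and differentiable coincide; thus [q] only has to be derivable in the direction v. *)
Lemma derive_comp (f : V -> W) (q : T -> V) t v :
  differentiable f (q t) -> derivable q t v ->
  derivable (f \o q) t v /\ 'D_v (f \o q) t = 'd f (q t) ('D_v q t).
Proof.
move=> df /derivable1P dq.
set p := (fun h : R => q (h *: v + t)) in dq.
have p0 : p 0 = q t by rewrite /p scale0r add0r.
have dp : differentiable p 0 by exact/derivable1_diffP.
have dfp : differentiable f (p 0) by rewrite p0.
have dc : differentiable (f \o p) 0 by exact: differentiable_comp.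
split; first by apply/derivable1P/derivable1_diffP.
rewrite derive_line0 -[LHS]derive1E (_ : (fun r : R => _) = f \o p) //.
rewrite derive1E' // diff_comp //= p0; congr ('d f (q t) _).
by rewrite derive_line0 -[RHS]derive1E derive1E'.
Qed.

End ChainRule.

Section CkComp.
Variables (R : realType) (T V : normedModType R) (I : finType).
Variables (e : I -> V) (x : I -> {linear V -> R}).
Hypothesis ex : coordinate_system e x.

(** The derivative of the composite is the sum of the products of the coordinates of ['D_v q] with
    the partial derivatives of [f] composed with [q]; the induction hypothesis, general in [f],
    applies to the latter. *)
Lemma Ck_on_comp m n j (U : set T) (U' : set V) (q : T -> V)
    (f : V -> 'M[R]_(m, n)) : open U -> open U' ->
  (forall t, U t -> U' (q t)) -> Ck_on j U q -> Ck_on j U' f ->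
  Ck_on j U (f \o q).
Proof.
move=> oU oU' UU'; elim: j f => [|j IH] f Cq Cf.
  split; last by [].
  move=> t Ut; apply: (@continuous_comp _ _ _ q f).
    exact: Ck_on_cont Cq Ut.
  exact: Ck_on_cont Cf (UU' _ Ut).
have Cf1 : Ck_on 1 U' f by elim: {IH Cq} j Cf => [//|j IH] /Ck_on_pred.
have dq v t : U t -> derivable q t v by move=> Ut; exact: Ck_on_derivable Cq Ut.
have df t : U t -> differentiable f (q t).
  by move=> Ut; exact: (C1_differentiable ex oU' Cf1 (UU' _ Ut)).
split.
  move=> t Ut; apply: (@continuous_comp _ _ _ q f).
    exact: Ck_on_cont Cq Ut.
  exact: Ck_on_cont Cf (UU' _ Ut).
move=> v; split.
  by move=> t Ut; exact: (derive_comp (df t Ut) (dq v t Ut)).1.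
apply: (@Ck_on_eq _ _ _ _ _ (fun t => \sum_i x i ('D_v q t) *: ('D_(e i) f \o q) t)) => //.
  move=> t Ut; rewrite (derive_comp (df t Ut) (dq v t Ut)).2.
  by rewrite -(deriveE _ (df t Ut)) (derive_coord ex oU' _ Cf1 (UU' _ Ut)).
apply: Ck_on_sum => // i _; apply: Ck_onZ => //.
  apply: (@Ck_on_lin _ _ _ _ (x i)) => //; first exact: ex.1.
  exact: Ck_on_derive.
apply: IH; first exact: Ck_on_pred.
exact: Ck_on_derive.
Qed.

End CkComp.

Section Coordinates.
Variable R : realType.

Lemma coordinates_R : coordinate_system (fun _ : unit => (1 : R)) (fun _ => (idfun : {linear R -> R})).
Proof.
split=> [_|v]; first by move=> z; exact: cvg_id.
by rewrite big_const card_unit /= addr0 /GRing.scale /= mulr1.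
Qed.

Lemma coordinates_cV n : exists x : 'I_n -> {linear 'cV[R]_n -> R},
  (forall i v, x i v = v i 0) /\
  coordinate_system (fun i : 'I_n => delta_mx i 0 : 'cV[R]_n) x.
Proof.
pose x0 (i : 'I_n) (v : 'cV[R]_n) := v i 0 : R.
have xl i : linear (x0 i) by move=> a u v; rewrite /x0 !mxE.
pose L i : {linear 'cV[R]_n -> R} :=
  HB.pack (x0 i) (GRing.isLinear.Build _ _ _ _ (x0 i) (xl i)).
exists L.
split=> //; split=> [i|v]; first exact: coord_continuous.
apply/colP => j; rewrite summxE (bigD1 j) //= big1 ?addr0 => [|i /negbTE ij].
  by rewrite !mxE !eqxx mulr1.
by rewrite !mxE eq_sym ij mulr0.
Qed.

End Coordinates.

(** * Ordinary differential equations *)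

Section Antiderivative.
Variable R : realType.

Lemma antiderivative_real (f : R -> R) : continuous f ->
  exists G : R -> R, G 0 = 0 /\ forall t : R, `|t| < 1 -> is_derive t 1 G (f t).
Proof.
move=> cf.
(* Integrating from -1 makes 0 an interior point, where the fundamental theorem gives a two-sided
   derivative. *)
pose G0 (x : R) : R := (\int[lebesgue_measure]_(t in [set` `[-1, x]]) f t)%R.
exists (fun x => G0 x - G0 0); split; first exact: subrr.
move=> t; rewrite ltr_norml => /andP[t1 t2].
have fi : (@lebesgue_measure R).-integrable `[-1, 1] (EFin \o f).
  apply: continuous_compact_integrable; first exact: segment_compact.
  exact: continuous_subspaceT.
have [d1 d2] := @continuous_FTC1_closed R f (-1) t 1 t2 fi t1 (cf t).
have h : is_derive t 1 G0 (f t) by split; [exact: d1|exact: (etrans (esym (derive1E _ _)) d2)].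
by rewrite -[f t]subr0; apply: is_deriveB.
Qed.

Lemma antiderivative n (f : R -> 'cV[R]_n) : continuous f ->
  exists G : R -> 'cV[R]_n, G 0 = 0 /\
    forall t : R, `|t| < 1 -> is_derive t 1 G (f t).
Proof.
move=> cf.
have [G hG] : {G : 'I_n -> R -> R & forall i, G i 0 = 0 /\
    forall t : R, `|t| < 1 -> is_derive t 1 (G i) (f t i 0)}.
  apply: (@choice _ _ (fun i g => g 0 = 0 /\
    forall t : R, `|t| < 1 -> is_derive t 1 g (f t i 0))) => i.
  apply: antiderivative_real => t.
  apply: (@continuous_comp _ _ _ f (fun M => M i 0)); first exact: cf.
  exact: coord_continuous.
exists (fun t => \col_i G i t); split.
  by apply/colP => i; rewrite !mxE (hG i).1.
move=> t t1.
have D : derivable (fun t => \col_i G i t) t 1.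
  apply/derivable_mxP => i j.
  rewrite (_ : (fun x => _) = G i); last by apply/funext => s; rewrite mxE.
  by have [] := (hG i).2 t t1.
split=> //; rewrite derive_mx //; apply/colP => i; rewrite mxE.
rewrite (_ : (fun x => _) = G i); last by apply/funext => s; rewrite mxE.
by have [_] := (hG i).2 t t1.
Qed.

Lemma norm_primitive_le n (G g : R -> 'cV[R]_n) (C t : R) : 0 <= C ->
  G 0 = 0 -> (forall s : R, `|s| < 1 -> is_derive s 1 G (g s)) ->
  (forall s : R, `|s| < 1 -> `|g s| <= C) -> `|t| < 1 -> `|G t| <= C * `|t|.
Proof.
move=> C0 G0 dG gC t1; apply: mx_norm_le => [|i j]; first exact: mulr_ge0.
have st (s : R) : 0 <= s <= 1 -> `|s *: t + 0| < 1.
  move=> /andP[s0 s1]; rewrite addr0 normrM ger0_norm //.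
  by rewrite (le_lt_trans _ t1) // ler_piMl.
have Dt (s : R) : `|s| < 1 -> derivable (fun z => G z i j) s t /\
    'D_t (fun z => G z i j) s = t * g s i j.
  move=> s1; have [d1 d2] := dG s s1.
  have /derivable_mxP/(_ i j) d3 := d1.
  have [] := @derive_scalev R R R (fun z => G z i j) s 1 t d3.
  rewrite /GRing.scale /= mulr1 => d4 ->; split=> //.
  by congr (_ * _); rewrite -d2 derive_mx ?mxE.
have [s sI|c cI] := @mean_value R R (fun z => G z i j) 0 t.
  exact: (Dt _ (st s sI)).1.
rewrite (Dt _ (st c cI)).2 addr0 G0 mxE subr0 => ->.
rewrite normrM mulrC ler_wpM2r //; apply: le_trans (mx_norm_ge _ i j) _.
exact: gC (st c cI).
Qed.

End Antiderivative.

(** * Local existence of solutions *)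

Section LocallyLipschitz.
Variables (R : realType) (N : nat).

(** On a small closed ball, which is convex, each partial derivative is bounded by its norm at [y0]
    plus 1; the mean value theorem along segments then gives the sum of these bounds as Lipschitz
    constant. *)
Lemma locally_lipschitz (U : set 'cV[R]_N) (F : 'cV[R]_N -> 'cV[R]_N) y0 :
  open U -> U y0 -> Ck_on 1 U F ->
  exists r L : R, [/\ 0 < r, 0 <= L, forall z, `|z - y0| <= r -> U z &
    forall z w, `|z - y0| <= r -> `|w - y0| <= r -> `|F z - F w| <= L * `|z - w|].
Proof.
move=> oU Uy0 CF.
have [x [xE cx]] := coordinates_cV R N.
pose e (i : 'I_N) := delta_mx i 0 : 'cV[R]_N.
have near1 : \forall z \near y0, forall i : 'I_N, `|'D_(e i) F y0 - 'D_(e i) F z| <= 1.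
  suff h (i : 'I_N) : \forall z \near y0, `|'D_(e i) F y0 - 'D_(e i) F z| <= 1.
    exact: (@filter_forall _ _ _ _ (nbhs_filter y0) h).
  have c := Ck_on_cont (Ck_on_derive (e i) CF) Uy0.
  exact: ((cvgrPdist_le _ _).1 c (1 : R) (@ltr01 R)).
have : nbhs y0 (U `&` _) := filterI (open_nbhs_nbhs (conj oU Uy0)) near1.
move=> /(_ _) /nbhs_ballP [r0 r00 hr].
have hr' z : `|z - y0| <= r0 / 2 -> U z /\ forall i : 'I_N, `|'D_(e i) F y0 - 'D_(e i) F z| <= 1.
  move=> zr; apply: hr; rewrite -ball_normE /= distrC (le_lt_trans zr) //.
  by rewrite ltr_pdivrMr // ltr_pMr // ltrDl.
pose L := \sum_(i < N) (`|'D_(e i) F y0| + 1).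
exists (r0 / 2), L; split.
- by rewrite divr_gt0.
- by apply: sumr_ge0 => i _; rewrite addr_ge0.
- by move=> z /hr' [].
move=> z w zr wr; apply: mx_norm_le => [|i j].
  by rewrite mulr_ge0 //; apply: sumr_ge0 => i _; rewrite addr_ge0.
have seg (s : R) : 0 <= s <= 1 -> `|s *: (z - w) + w - y0| <= r0 / 2.
  move=> /andP[s0 s1].
  rewrite (_ : _ - y0 = s *: (z - y0) + (1 - s) *: (w - y0)); last first.
    by apply/matrixP => a b; rewrite !mxE; ring.
  apply: le_trans (ler_normD _ _) _.
  rewrite !normrZ !ger0_norm ?subr_ge0 //.
  apply: (@le_trans _ _ (s * (r0 / 2) + (1 - s) * (r0 / 2))).
    by apply: lerD; apply: ler_wpM2l => //; rewrite subr_ge0.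
  by rewrite -mulrDl addrC subrK mul1r.
have [s sI|c cI] := @mean_value R _ (fun u => F u i j) w (z - w).
  have [Us _] := hr' _ (seg s sI).
  by have /derivable_mxP := @Ck_on_derivable _ _ _ _ _ _ (z - w) _ CF Us.
have [Uc hc] := hr' _ (seg c cI).
rewrite subrK !mxE => ->.
have -> : 'D_(z - w) (fun u => F u i j) (c *: (z - w) + w) =
    ('D_(z - w) F (c *: (z - w) + w)) i j.
  by rewrite derive_mx ?mxE //; exact: Ck_on_derivable CF Uc.
apply: le_trans (mx_norm_ge _ i j) _.
rewrite (derive_coord cx oU _ CF Uc).
apply: le_trans (ler_norm_sum _ _ _) _.
rewrite /L mulr_suml; apply: ler_sum => l _.
rewrite normrZ mulrC; apply: ler_pM => //.
  rewrite -/(e l) -[X in `|X|](subrK ('D_(e l) F y0)) addrC.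
  apply: le_trans (ler_normD _ _) _; rewrite lerD2l.
  by rewrite distrC.
by rewrite xE mx_norm_ge.
Qed.

End LocallyLipschitz.

Lemma geometric_small (R : realType) (c e : R) : 0 < e -> exists k, c / 2 ^+ k <= e.
Proof.
move=> e0; exists (Num.bound (c / e)).
rewrite ler_pdivrMr ?exprn_gt0 // mulrC -ler_pdivrMr //.
apply: le_trans (ltW (le_lt_trans (ler_norm _) (archi_boundP (normr_ge0 _)))) _.
have -> : Num.bound `|c / e| = Num.bound (c / e).
  by rewrite /Num.bound /Num.Def.archi_bound normr_id.
by rewrite -natrX ler_nat ltnW // ltn_expl.
Qed.

Lemma near_abs_lt (R : realType) (t d : R) : `|t| < d -> \forall u \near t, `|u| < d.
Proof.
move=> td; apply/nbhs_ballP; exists (d - `|t|) => [|u]; first by rewrite /= subr_gt0.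
rewrite /ball /= ltrBrDr; apply: le_lt_trans; rewrite -lerBlDr.
by rewrite distrC; exact: lerB_dist.
Qed.

Section Picard.
Variables (R : realType) (N : nat).

Lemma picard_lindelof (U : set 'cV[R]_N) (F : 'cV[R]_N -> 'cV[R]_N) y0 :
  open U -> U y0 -> Ck_on 1 U F ->
  exists (d : R) (y : R -> 'cV[R]_N), [/\ 0 < d, y 0 = y0,
    forall t, `|t| < d -> U (y t) &
    forall t : R, `|t| < d -> is_derive t 1 y (F (y t))].
Proof.
move=> oU Uy0 CF.
have [r [L [r0 L0 rU lip]]] := locally_lipschitz oU Uy0 CF.
pose B (z : 'cV[R]_N) := `|z - y0| <= r.
pose K := `|F y0| + L * r.
have K0 : 0 <= K by rewrite addr_ge0 // mulr_ge0 // ltW.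
have FK z : B z -> `|F z| <= K.
  move=> Bz; rewrite -[F z](subrK (F y0)) addrC.
  apply: le_trans (ler_normD _ _) _; rewrite lerD2l.
  apply: le_trans (lip _ _ Bz _) _; first by rewrite subrr normr0 ltW.
  by rewrite ler_wpM2l.
have FC z : B z -> {for z, continuous F}.
  by move=> Bz; exact: (Ck_on_cont CF (rU z Bz)).
(* The length d is chosen for three inequalities: d < 1, as primitives are only available on ]-1,
   1[; K d <= r, so that iterates stay in the ball; L d <= 1/2, so that the Picard operator halves
   distances. *)
pose m := Num.min 1 r; pose d := m / (2 * (K + L + 1)).
have m0 : 0 < m by rewrite lt_min ltr01.
have m1 : m <= 1 by rewrite ge_min lexx.
have mr : m <= r by rewrite ge_min lexx orbT.
have KL : 0 < 2 * (K + L + 1) by rewrite mulr_gt0 // ltr_wpDl // addr_ge0.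
have d0 : 0 < d by rewrite divr_gt0.
have dE : d * (2 * (K + L + 1)) = m by rewrite /d divfK // gt_eqF.
have d1 : d < 1 by nra.
have Kd : K * d <= r by nra.
have Ld : L * d <= 1 / 2 by nra.
(* The projection of t onto [-d, d]: with time frozen outside this interval,
   the Picard iterates are defined and continuous on the whole line. *)
pose tau (t : R) : R := (`|t + d| - `|t - d|) / 2.
have dist2 (a b : R) : `|a - b| / 2 + `|a - b| / 2 = `|a - b| by field.
have tauD a b (c : R) : `|a - b| <= 2 * c -> `|(`|a| - `|b|) / 2| <= c.
  move=> h; rewrite normrM [X in _ * X]ger0_norm ?invr_ge0 // ler_pdivrMr // mulrC.
  exact: le_trans (ler_dist_dist _ _) h.
have taud t : `|tau t| <= d.
  apply: tauD; rewrite (_ : t + d - (t - d) = 2 * d); last by ring.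
  by rewrite ger0_norm // mulr_ge0 // ltW.
have tau1 t : `|tau t| < 1 by exact: le_lt_trans (taud t) d1.
have tauE t : `|t| < d -> tau t = t.
  rewrite ltr_norml /tau => /andP[h1 h2].
  rewrite ger0_norm ?ler0_norm; [by field|by rewrite subr_le0 ltW|].
  by rewrite -lerBlDr sub0r ltW.
have tauC : continuous tau.
  move=> t; apply/cvgrPdist_le => e e0; apply/nbhs_ballP; exists e => // u.
  rewrite /ball /= => /ltW; apply: le_trans.
  rewrite (_ : tau t - tau u = (`|t + d| - `|u + d|) / 2 - (`|t - d| - `|u - d|) / 2);
    last by rewrite /tau; field.
  apply: le_trans (ler_normB _ _) _; rewrite -[leRHS]dist2.
  by apply: lerD; apply: tauD; rewrite mulrC divfK // opprD addrACA ?subrr ?addr0 // opprK addNr addr0.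
pose good (f : R -> 'cV[R]_N) := continuous f /\ forall t, B (f t).
have [G HG] : {G : (R -> 'cV[R]_N) -> R -> 'cV[R]_N & forall f, good f ->
    G f 0 = 0 /\ forall t : R, `|t| < 1 -> is_derive t 1 (G f) (F (f t))}.
  apply: (@choice _ _ (fun f g => good f ->
    g 0 = 0 /\ forall t : R, `|t| < 1 -> is_derive t 1 g (F (f t)))) => f.
  (* For functions that are not [good] the value of [G] is irrelevant; the constant 0 is a
     default. *)
  have [[fC fB]|] := pselect (good f); last by move=> nf; exists (cst 0).
  have [|g hg] := @antiderivative R N (F \o f).
    move=> t; apply: (@continuous_comp _ _ _ f F); [exact: fC|exact: FC].
  by exists g.
pose T f (t : R) := y0 + G f (tau t).
have GB f t : good f -> `|t| < 1 -> `|G f t| <= K * `|t|.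
  move=> gf t1; have [g0 g1] := HG f gf.
  apply: (norm_primitive_le K0 g0 g1 _ t1) => s _.
  by apply: FK; exact: gf.2.
have Gcont f t : good f -> `|t| < 1 -> {for t, continuous (G f)}.
  move=> gf t1; have [_ g1] := HG f gf.
  apply: differentiable_continuous; apply/derivable1_diffP.
  by have [] := g1 t t1.
have Tgood f : good f -> good (T f).
  move=> gf; split=> t.
    apply: (@cvgD _ _ _ _ _ (cst y0) (fun s => G f (tau s))); first exact: cvg_cst.
    apply: (@continuous_comp _ _ _ tau (G f)); first exact: tauC.
    exact: Gcont.
  rewrite /B /T addrC addrA addNr add0r; apply: le_trans (GB f _ gf (tau1 t)) _.
  by apply: le_trans Kd; rewrite ler_wpM2l.
have Tlip f g c : good f -> good g -> 0 <= c -> (forall t, `|f t - g t| <= c) ->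
    forall t, `|T f t - T g t| <= c / 2.
  move=> gf gg c0 fg t; have [f0 f1] := HG f gf; have [h0 h1] := HG g gg.
  rewrite /T opprD addrACA subrr add0r.
  have := @norm_primitive_le R N (fun t => G f t - G g t)
    (fun t => F (f t) - F (g t)) (L * c) (tau t).
  move=> /(_ _ _ _ _ (tau1 t)) h; apply: le_trans (h _ _ _ _) _.
  - by rewrite mulr_ge0.
  - by rewrite f0 h0 subrr.
  - by move=> s s1; apply: is_deriveB; [exact: f1|exact: h1].
  - move=> s _; apply: le_trans (lip _ _ (gf.2 s) (gg.2 s)) _.
    by rewrite ler_wpM2l.
  - have := taud t; move: (`|tau t|) => u ud.
    apply: (@le_trans _ _ (c * (L * d))); last by nra.
    by rewrite mulrAC mulrC ler_wpM2l // ler_wpM2l.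
pose s k := iter k T (cst y0).
have sgood k : good (s k).
  elim: k => [|k IH]; last exact: Tgood.
  split=> [|t]; first exact: cst_continuous.
  by rewrite /B /s /= subrr normr0 ltW.
have step k t : `|s k.+1 t - s k t| <= r / 2 ^+ k.
  elim: k t => [|k IH] t.
    rewrite expr0 divr1 /s /= /T addrC addKr.
    apply: le_trans (GB _ _ (sgood 0) (tau1 t)) _.
    by apply: le_trans Kd; rewrite ler_wpM2l.
  rewrite exprSr invfM mulrA; apply: (Tlip (s k.+1) (s k)) => //.
  by rewrite divr_ge0 ?exprn_ge0 // ltW.
have scauchy k p t : `|s (k + p)%N t - s k t| <= 2 * r / 2 ^+ k.
  (* The induction on p needs the exact partial sum of the geometric series, not only its bound. *)
  apply: (@le_trans _ _ (2 * r / 2 ^+ k - 2 * r / 2 ^+ (k + p))); last first.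
    by rewrite gerBl divr_ge0 ?exprn_ge0 // mulr_ge0 // ltW.
  elim: p => [|p IH]; first by rewrite addn0 !subrr normr0.
  rewrite -[s _ t](subrK (s (k + p)%N t)) -addrA.
  apply: le_trans (ler_normD _ _) _.
  have := lerD (step (k + p)%N t) IH; rewrite -addnS => h; apply: le_trans h _.
  rewrite addnS exprSr invfM.
  move: (2 ^+ (k + p))^-1 => v; lra.
have limP t : exists l, forall k, `|l - s k t| <= 2 * r / 2 ^+ k.
  have cv : cvg ((fun k => s k t) @ \oo).
    apply: cauchy_cvg; apply: cauchy_exP => e /= e0.
    have [k hk] := geometric_small (2 * r) (divr_gt0 e0 (ltr0n R 2)).
    exists (s k t); exists k => // n /= kn.
    rewrite -ball_normE /= distrC -(subnKC kn) (le_lt_trans (scauchy _ _ _)) //.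
    by rewrite (le_lt_trans hk) // ltr_pdivrMr // ltr_pMr // ltrDl.
  exists (lim ((fun k => s k t) @ \oo)) => k.
  apply/ler_addgt0Pl => e e0.
  have [M _ hM] := (cvgrPdist_le _ _).1 cv e e0.
  have := hM (k + M)%N (leq_addl _ _) => /= h1.
  rewrite -[lim _](subrK (s (k + M)%N t)) -addrA.
  by apply: le_trans (ler_normD _ _) _; apply: lerD.
have [y yP] : {y : R -> 'cV[R]_N & forall t k, `|y t - s k t| <= 2 * r / 2 ^+ k}.
  exact: choice limP.
have ygood : good y.
  split=> t; last first.
    apply/ler_addgt0Pl => e e0; have [k hk] := geometric_small (2 * r) e0.
    rewrite -[y t](subrK (s k t)) -addrA.
    apply: le_trans (ler_normD _ _) _; apply: lerD; last exact: (sgood k).2.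
    exact: le_trans (yP t k) hk.
  apply/cvgrPdist_le => e e0; have e3 : 0 < e / 3 by rewrite divr_gt0.
  have [k hk] := geometric_small (2 * r) e3.
  have near3 : \forall u \near t, `|s k t - s k u| <= e / 3.
    exact: ((cvgrPdist_le _ _).1 ((sgood k).1 t) _ e3).
  apply: filterS near3 => u hu.
  rewrite (_ : y t - y u = (y t - s k t) + (s k t - s k u) + (s k u - y u)); last first.
    by rewrite !subrKA.
  apply: le_trans (ler_normD _ _) _.
  rewrite [X in _ <= X](_ : e = e / 3 + e / 3 + e / 3); last by field.
  apply: lerD; last by rewrite distrC; exact: le_trans (yP u k) hk.
  apply: le_trans (ler_normD _ _) _; apply: lerD => //.
  exact: le_trans (yP t k) hk.
(* Both sides are geometrically close to the iterate [s k.+1], since T halves the distance between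
   [s k] and [y]. *)
have yfix t : y t = T y t.
  apply/eqP; rewrite -subr_eq0 -normr_le0; apply/ler_addgt0Pl => e e0; rewrite addr0.
  have [k hk] := geometric_small (2 * r) e0.
  rewrite -[y t](subrK (s k.+1 t)) -addrA.
  apply: le_trans (ler_normD _ _) _.
  have h1 := yP t k.+1.
  have hs u : `|s k u - y u| <= 2 * r / 2 ^+ k by rewrite distrC.
  have h2 := Tlip (s k) y _ (sgood k) ygood (le_trans (normr_ge0 _) (hs 0)) hs t.
  apply: le_trans (lerD h1 h2) _; rewrite exprSr invfM.
  by move: hk; move: (2 ^+ k)^-1 => v; lra.
exists d, y; split=> //.
- by rewrite yfix /T tauE ?normr0 // (HG y ygood).1 addr0.
- by move=> t _; apply: rU; exact: ygood.2.
- move=> t td.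
  have t1 : `|t| < 1 by exact: lt_trans td d1.
  apply: (@near_eq_is_derive _ _ _ (fun t => y0 + G y t)).
    apply: filterS (near_abs_lt td) => u ud.
    by rewrite [RHS]yfix /T tauE.
  rewrite -[F _]add0r.
  exact: (@is_deriveD _ _ _ (cst y0) (G y) t 1 0 (F (y t)) (is_derive_cst _ _ _)
    ((HG y ygood).2 t t1)).
Qed.

End Picard.

(** * Regularity of solutions *)

Section MoreCk.
Variables (R : realType).

Lemma Ck_onV (V : normedModType R) j (U : set V) (f : V -> R) : open U ->
  (forall x, U x -> f x != 0) -> Ck_on j U f -> Ck_on j U (fun x => (f x)^-1).
Proof.
move=> oU f0; elim: j => [|j IH] Cf.
  split; last by [].
  by move=> x Ux; apply: cvgV; [exact: f0|exact: Ck_on_cont Cf Ux].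
have CV := IH (Ck_on_pred Cf).
split; first by move=> x Ux; exact: Ck_on_cont CV Ux.
move=> v; split.
  by move=> x Ux; apply: derivableV; [exact: f0|exact: Ck_on_derivable Cf Ux].
apply: (@Ck_on_eq _ _ _ _ _ (fun x => (- 1 * 'D_v f x) * ((f x)^-1 * (f x)^-1))) => //.
  move=> x Ux; rewrite deriveV; [|exact: f0|exact: Ck_on_derivable Cf Ux].
  by rewrite /GRing.scale /= mulN1r expr2 invfM !mulNr mulrC.
apply: Ck_onM => //; last exact: Ck_onM.
by apply: Ck_onM => //; [exact: Ck_on_cst|exact: Ck_on_derive].
Qed.

Lemma derive_scale (V : normedModType R) m n (s : V -> R) (f : V -> 'M[R]_(m, n)) t v :
  derivable s t v -> derivable f t v ->
  derivable (fun x => s x *: f x) t v /\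
  'D_v (fun x => s x *: f x) t = 'D_v s t *: f t + s t *: 'D_v f t.
Proof.
move=> ds df.
have e i j : (fun x => (s x *: f x) i j) = s * (fun x => f x i j).
  by apply/funext => x; rewrite mxE.
have dij i j : derivable (fun x => f x i j) t v.
  exact: ((derivable_mxP f t v).1 df i j).
have d : derivable (fun x => s x *: f x) t v.
  apply/derivable_mxP => i j; rewrite e; exact: (derivableM ds (dij i j)).
split; first exact: d.
rewrite (derive_mx d) (derive_mx df); apply/matrixP => i j.
rewrite !mxE e (deriveM ds (dij i j)) addrC /GRing.scale /=.
by congr (_ + _); exact: mulrC.
Qed.

Lemma Ck_on_line j (I : set R) m n (f : R -> 'M[R]_(m, n)) : open I ->
  (forall t, I t -> derivable f t 1) -> Ck_on j I ('D_1 f) -> Ck_on j.+1 I f.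
Proof.
move=> oI df Cf; split.
  by move=> t It; apply: differentiable_continuous; apply/derivable1_diffP; exact: df.
move=> v; have D t : I t -> derivable f t v /\ 'D_v f t = v *: 'D_1 f t.
  move=> It; have := @derive_scalev R R _ f t 1 v (df t It).
  by rewrite /GRing.scale /= mulr1.
split; first by move=> t It; exact: (D t It).1.
apply: (@Ck_on_eq _ _ _ _ _ (fun t => v *: 'D_1 f t)) => //.
  by move=> t It; rewrite (D t It).2.
by apply: Ck_onZ => //; exact: Ck_on_cst.
Qed.

Lemma open_abs_lt (d : R) : open [set t : R | `|t| < d].
Proof. by rewrite openE => t td; exact: near_abs_lt. Qed.

(** Bootstrap: if [y] is C^j, then so is its derivative [F \o y], and [y] is C^(j+1). *)
Lemma smooth_ode_solution N (U : set 'cV[R]_N) (F : 'cV[R]_N -> 'cV[R]_N) (d : R) (y : R -> 'cV[R]_N) :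
  open U -> smooth_on U F -> (forall t, `|t| < d -> U (y t)) ->
  (forall t : R, `|t| < d -> is_derive t 1 y (F (y t))) ->
  smooth_on [set t : R | `|t| < d] y.
Proof.
move=> oU SF yU dy j.
have [x [_ cx]] := coordinates_cV R N.
have dy1 t : `|t| < d -> derivable y t 1 by move=> /dy [].
elim: j => [|j IH].
  split; last by [].
  by move=> t td; apply: differentiable_continuous; apply/derivable1_diffP; exact: dy1.
apply: Ck_on_line => //; first exact: open_abs_lt.
apply: (@Ck_on_eq _ _ _ _ _ (F \o y)); first exact: open_abs_lt.
  by move=> t /dy [].
by apply: (Ck_on_comp cx _ oU yU IH (SF j)); exact: open_abs_lt.
Qed.

Lemma Ck_on_atan j : Ck_on j setT (@atan R).
Proof.
case: j => [|j].
  split; last by [].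
  by move=> t _; exact: continuous_atan.
split; first by move=> t _; exact: continuous_atan.
have da (t v : R) : derivable (@atan R) t v /\ 'D_v (@atan R) t = v * (1 + t * t)^-1.
  have [d1 d2] := is_derive1_atan t.
  have := @derive_scalev R R _ (@atan R) t 1 v d1.
  by rewrite /GRing.scale /= mulr1 d2 expr2.
move=> v; split; first by move=> t _; exact: (da t v).1.
apply: (@Ck_on_eq R R R j setT (fun t => v * (1 + t * t)^-1) _ openT).
  by move=> t _; rewrite (da t v).2.
have oT : open [set: R] := openT.
apply: Ck_onM => //; first exact: Ck_on_cst.
apply: Ck_onV => //.
  by move=> t _; rewrite gt_eqF // ltr_wpDr // -expr2 sqr_ge0.
apply: Ck_onD => //; first exact: Ck_on_cst.
by apply: Ck_onM => //; exact: Ck_on_id.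
Qed.

End MoreCk.

(** * Reparametrized geodesics *)

Section Geodesic.
Variables (R : realType).

Lemma Ck_on_mxsub m n m' n' j (U : set 'M[R]_(m, n)) (f : 'I_m' -> 'I_m) (g : 'I_n' -> 'I_n)
    (S : 'M[R]_(m, n) -> 'M[R]_(m', n')) :
  open U -> (forall A i k, S A i k = A (f i) (g k)) -> Ck_on j U S.
Proof.
move=> oU SE; apply/(Ck_on_mx _ _ oU) => i k.
apply: (@Ck_on_eq R 'M[R]_(m, n) R j U (fun A => A (f i) (g k))) => //.
by apply: (Ck_on_mx j (fun x => x) oU).2; exact: Ck_on_id.
Qed.

(* A-planarity only involves curves defined on the whole line, whereas geodesics
   need not be complete. The reparametrization by a multiple of atan, whose
   derivative never vanishes, keeps the covariant acceleration proportional to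
   the velocity. *)
Lemma exists_geodesic n (U : set 'cV[R]_n) (Gam : 'cV[R]_n -> 'cV[R]_n -> 'M[R]_n) p0 u0 :
  open U -> U p0 -> (forall p, U p -> linear (Gam p)) ->
  (forall u, smooth_on U (Gam^~ u)) ->
  exists (q : R -> 'cV[R]_n) (a : R),
    [/\ (forall j, Ck_on j setT q), (forall r, U (q r)), q 0 = p0,
        a != 0 /\ 'D_1 q 0 = a *: u0 &
        forall r, exists l : R,
          'D_1 ('D_1 q) r + Gam (q r) ('D_1 q r) *m 'D_1 q r = l *: 'D_1 q r].
Proof.
move=> oU Up0 lG SG.
have CuT j : Ck_on j setT (@usubmx R n n 1).
  by apply: (@Ck_on_mxsub (n + n) 1 n 1 j setT (lshift n) id _ openT) => A i k; rewrite mxE.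
have CdT j : Ck_on j setT (@dsubmx R n n 1).
  by apply: (@Ck_on_mxsub (n + n) 1 n 1 j setT (@rshift n n) id _ openT) => A i k; rewrite mxE.
have uC : continuous (@usubmx R n n 1) by move=> y; exact: Ck_on_cont (CuT 0) I.
have dC : continuous (@dsubmx R n n 1) by move=> y; exact: Ck_on_cont (CdT 0) I.
(* The geodesic equation becomes a first-order system: the upper half of the vector is the position,
   the lower half the velocity. *)
pose U2 := [set y : 'cV[R]_(n + n) | U (usubmx y)].
have oU2 : open U2 by apply: (@open_comp _ _ (@usubmx R n n 1)) => // y _; exact: uC.
have [x [_ cx]] := coordinates_cV R n.
(* Minus Gam(v)v, expanded in the coordinates of one occurrence of v, because [Gam] is only known to
   be smooth for a fixed second argument. *)
pose a2 (y : 'cV[R]_(n + n)) : 'cV[R]_n :=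
  \sum_(i < n) (- (dsubmx y) i 0) *: (Gam (usubmx y) (delta_mx i 0) *m dsubmx y).
have a2E y : U (usubmx y) -> a2 y = - (Gam (usubmx y) (dsubmx y) *m dsubmx y).
  move=> /lG lGy; pose L := HB.pack_for {linear 'cV[R]_n -> 'M[R]_n} (Gam (usubmx y))
    (GRing.isLinear.Build _ _ _ _ _ lGy).
  have -> : Gam (usubmx y) (dsubmx y) =
      \sum_(i < n) (dsubmx y) i 0 *: Gam (usubmx y) (delta_mx i 0).
    have e : dsubmx y = \sum_(i < n) (dsubmx y) i 0 *: delta_mx i 0.
      by rewrite {1}[dsubmx y]matrix_sum_delta; apply: eq_bigr => i _; rewrite big_ord1.
    transitivity (L (\sum_(i < n) (dsubmx y) i 0 *: delta_mx i 0)); first by rewrite -e.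
    by rewrite linear_sum; apply: eq_bigr => i _; rewrite linearZ.
  rewrite mulmx_suml -sumrN; apply: eq_bigr => i _.
  by rewrite scaleNr scalemxAl.
have CF j : Ck_on j U2 (fun y => col_mx (dsubmx y) (a2 y)).
  have Cd : Ck_on j U2 (@dsubmx R n n 1) by apply: Ck_on_sub (CdT j).
  have Cu : Ck_on j U2 (@usubmx R n n 1) by apply: Ck_on_sub (CuT j).
  have Ca : Ck_on j U2 a2.
    apply: Ck_on_sum => // i _; apply: Ck_onZ => //.
      apply: (@Ck_on_eq _ _ _ _ _ (fun y => (-1) * (dsubmx y) i 0)) => //.
        by move=> y _; rewrite mulN1r.
      by apply: Ck_onM => //; [exact: Ck_on_cst|exact: (Ck_on_mx _ _ oU2).2].
    apply: Ck_on_mul => //.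
    apply: (Ck_on_comp cx oU2 oU _ Cu (SG (delta_mx i 0) j)) => y; exact.
  apply/(Ck_on_mx _ _ oU2) => i k; case: (split_ordP i) => l ->.
    apply: (@Ck_on_eq _ _ _ _ _ (fun y => dsubmx y l k)) => //.
      by move=> y _; rewrite col_mxEu.
    exact: (Ck_on_mx _ _ oU2).2.
  apply: (@Ck_on_eq _ _ _ _ _ (fun y => a2 y l k)) => //.
    by move=> y _; rewrite col_mxEd.
  exact: (Ck_on_mx _ _ oU2).2.
have U20 : U2 (col_mx p0 u0) by rewrite /U2 /= col_mxKu.
have [d [y [d0 y0 yU dy]]] := picard_lindelof oU2 U20 (CF 1).
have Sy := smooth_ode_solution oU2 CF yU dy.
(* Since |atan| < pi/2 < 2, the values of [phi] stay in the interval ]-d, d[ where the solution is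
   defined. *)
pose phi (t : R) := d / 2 * atan t.
have oT : open [set: R] := openT.
have Cphi j : Ck_on j setT phi by apply: Ck_onM => //; [exact: Ck_on_cst|exact: Ck_on_atan].
have phid t : `|phi t| < d.
  rewrite /phi normrM (@ger0_norm _ (d / 2)) ?divr_ge0 // ?ltW //.
  rewrite mulrAC ltr_pdivrMr // ltr_pM2l //.
  have pi4 := pihalf_lt2 R.
  have := atan_gtNpi2 t; have := atan_ltpi2 t.
  by move=> h1 h2; rewrite ltr_norml; apply/andP; split; lra.
pose dphi (t : R) := d / 2 * (1 + t ^+ 2)^-1.
have dphi0 t : dphi t != 0.
  rewrite mulf_neq0 ?gt_eqF ?divr_gt0 // invr_gt0 ltr_wpDr // ?ltr01 //.
  exact: sqr_ge0.
have Dphi t : derivable phi t 1 /\ 'D_1 phi t = dphi t.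
  have [d1 d2] := is_derive1_atan t.
  have := @deriveZ R R R (@atan R) (d / 2) t 1 d1.
  rewrite d2 => h; split; [exact: (@derivableZ R R R (@atan R) (d / 2) t 1 d1)|exact: h].
pose Y t := y (phi t); pose v t := dsubmx (Y t).
have YU t : U (usubmx (Y t)) by exact: yU (phid t).
have DY t : derivable Y t 1 /\ 'D_1 Y t = dphi t *: col_mx (v t) (a2 (Y t)).
  have [y1 y2] := dy _ (phid t).
  have dfy : differentiable y (phi t) by exact/derivable1_diffP.
  have [h1 h2] := derive_comp dfy (Dphi t).1.
  split; first exact: h1.
  rewrite [LHS]h2 (Dphi t).2 -(deriveE _ dfy).
  have := (@derive_scalev R R _ y (phi t) 1 (dphi t) y1).2.
  by rewrite {1}/GRing.scale /= mulr1 y2.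
have Dq t : 'D_1 (usubmx \o Y) t = dphi t *: v t.
  by rewrite (derivable_lin uC (DY t).1).2 (DY t).2 linearZ /= col_mxKu.
have Dv t : derivable v t 1 /\ 'D_1 v t = dphi t *: a2 (Y t).
  have [h1 h2] := derivable_lin dC (DY t).1.
  by split; [exact: h1|rewrite [LHS]h2 (DY t).2 linearZ /= col_mxKd].
have Dd : 'D_1 phi = dphi by apply/funext => t; rewrite (Dphi t).2.
have Ddphi t : derivable dphi t 1.
  by rewrite -Dd; exact: (@Ck_on_derivable R R R 0 setT _ 1 t (@Ck_on_derive R R R 1 setT phi 1 (Cphi 2)) I).
have phi0 : phi 0 = 0 by rewrite /phi atan0 mulr0.
exists (usubmx \o Y), (dphi 0); split.
- move=> j; apply: (@Ck_on_lin _ _ _ _ (@usubmx R n n 1)) => //.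
  exact: (Ck_on_comp (coordinates_R R) oT (@open_abs_lt R d) (fun t _ => phid t) (Cphi j) (Sy j)).
- exact: YU.
- by rewrite /Y /= phi0 y0 col_mxKu.
- by rewrite Dq /v /Y phi0 y0 col_mxKd.
(* The velocity is phi' v. Its derivative is phi'' v plus phi'^2 times the acceleration, and the
   latter cancels against [Gam]; what remains is phi''/phi' times the velocity. *)
move=> t; exists ('D_1 dphi t / dphi t).
have -> : 'D_1 (usubmx \o Y) = (fun t => dphi t *: v t) by apply/funext.
rewrite (derive_scale (Ddphi t) (Dv t).1).2 (Dv t).2 a2E //.
have lGt : Gam (usubmx (Y t)) (dphi t *: v t) = dphi t *: Gam (usubmx (Y t)) (v t).
  pose L := HB.pack_for {linear 'cV[R]_n -> 'M[R]_n} (Gam (usubmx (Y t)))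
    (GRing.isLinear.Build _ _ _ _ _ (lG _ (YU t))).
  by rewrite -![Gam _ _]/(L _) linearZ.
rewrite /= !Dq lGt -scalemxAl -scalemxAr -/(v t) !scalerN addrNK scalerA.
by rewrite -mulrA mulVf ?mulr1.
Qed.

End Geodesic.

(** * Clifford algebras *)

Section CliffordSigns.

(* The exponent of the sign of the square of the product of the generators
   listed in r: moving i through r' contributes size r'. *)
Fixpoint clifford_exp (n s : nat) (r : seq 'I_n) : nat :=
  if r is i :: r' then (size r' + ~~ (i < s) + clifford_exp s r')%N else 0%N.

(** Computed from the index set alone, hence common to O and to all local frames of all
    manifolds. *)
Definition cl_sign (R : pzRingType) (s t : nat) (X : {set 'I_(s + t)}) : R :=
  (-1) ^+ clifford_exp s (enum X).

Lemma cl_sign_pm (R : pzRingType) s t (X : {set 'I_(s + t)}) :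
  cl_sign R X = 1 \/ cl_sign R X = -1.
Proof.
by rewrite /cl_sign -signr_odd; case: odd; [right|left]; rewrite ?expr1 ?expr0.
Qed.

Lemma cl_sign0 (R : pzRingType) s t : cl_sign R (finset.set0 : {set 'I_(s + t)}) = 1.
Proof.
suff h (X : {set 'I_(s + t)}) : (forall j, (j \in X) = false) -> cl_sign R X = 1.
  by apply: h => j; rewrite finset.in_set0.
move=> X0; rewrite /cl_sign; have := mem_enum X; case: (enum X) => [//|i r] /(_ i).
by rewrite mem_head X0.
Qed.

Lemma cl_sign_sq (R : pzRingType) s t (X : {set 'I_(s + t)}) :
  cl_sign R X * cl_sign R X = 1.
Proof. by case: (cl_sign_pm R X) => ->; rewrite ?mulr1 // mulrNN mulr1. Qed.

Variables (B : pzRingType) (s t : nat) (g : 'I_(s + t) -> B).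
Hypothesis hg : clifford_gens g.

Lemma anticomm_prod i (r : seq 'I_(s + t)) : i \notin r ->
  g i * \prod_(j <- r) g j = (-1) ^+ size r * (\prod_(j <- r) g j * g i).
Proof.
elim: r => [|j r IH] /=; first by rewrite big_nil expr0 !mulr1 !mul1r.
rewrite inE negb_or => /andP[ij ir]; rewrite big_cons mulrA (hg.2 _ _ ij) mulNr -mulrA IH //.
rewrite exprS mulN1r mulNr; congr (- _).
by rewrite !mulrA (commr_sign (g j) (size r)).
Qed.

Lemma prod_sq (r : seq 'I_(s + t)) : uniq r ->
  \prod_(j <- r) g j * \prod_(j <- r) g j = (-1) ^+ clifford_exp s r.
Proof.
elim: r => [|j r IH] /=; first by rewrite big_nil mul1r.
move=> /andP[jr ur]; rewrite big_cons.
set p := \prod_(j <- r) g j.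
have -> : g j * p * (g j * p) = (-1) ^+ size r * (g j * g j) * (p * p).
  have h := anticomm_prod jr; rewrite -/p in h.
  have h' : p * g j = (-1) ^+ size r * (g j * p) by rewrite h mulrA -exprD addnn -signr_odd odd_double mul1r.
  by rewrite -mulrA (mulrA p) h' !mulrA (commr_sign (g j) (size r)).
by rewrite hg.1 IH // !exprD; case: ifP => _; rewrite ?expr0 ?expr1.
Qed.

Lemma std_basisE (X : {set 'I_(s + t)}) : std_basis g X = \prod_(j <- enum X) g j.
Proof. by rewrite /std_basis -[LHS]big_filter [index_enum _]unlock. Qed.

Lemma std_basis_sq X : std_basis g X * std_basis g X = cl_sign B X.
Proof. by rewrite std_basisE prod_sq // enum_uniq. Qed.

(** The permutation of index sets that left multiplication by the generator [g i] induces on basis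
    elements, up to sign. *)
Definition toggle (i : 'I_(s + t)) (X : {set 'I_(s + t)}) : {set 'I_(s + t)} :=
  [set j | (j \in X) (+) (j == i)].

Lemma toggleK i : involutive (toggle i).
Proof. by move=> X; apply/setP => j; rewrite !inE -addbA addbb addbF. Qed.

(** The exponent makes induction on the list possible: [g i] travels to its own place in the ordered
    product, where it is inserted or squared away, provided the list contains that place. *)
Lemma prod_toggle i (X : {set 'I_(s + t)}) (r : seq 'I_(s + t)) : uniq r ->
  exists b : bool, g i ^+ (i \in r) * \prod_(j <- r | j \in X) g j =
    (-1) ^+ b * \prod_(j <- r | j \in toggle i X) g j.
Proof.
elim: r => [|a r IH] /=; first by exists false; rewrite !big_nil !mulr1.
move=> /andP[ar ur]; have [b hb] := IH ur.
rewrite !big_cons !inE; have [ia|ia] := eqVneq i a.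
  subst a; rewrite (negbTE ar) expr0 mul1r in hb.
  rewrite /= expr1 addbT.
  have [iX|iX] /= := boolP (i \in X).
    rewrite mulrA hg.1 hb; case: ifP => _; first by exists b; rewrite mul1r.
    by exists (~~ b); rewrite mulN1r; case: (b); rewrite /= ?expr0 ?expr1 ?mul1r ?mulN1r ?opprK.
  by exists b; rewrite hb !mulrA (commr_sign (g i) b).
rewrite /= addbF. 
case: (a \in X); last by exists b.
case: (i \in r) hb => hb; rewrite ?expr1 ?expr0 ?mul1r in hb *.
  exists (~~ b); rewrite mulrA (hg.2 _ _ ia) mulNr -mulrA hb.
  by case: (b); rewrite /= ?expr0 ?expr1 ?mul1r ?mulN1r ?mulrN ?opprK.
by exists b; rewrite hb !mulrA (commr_sign (g a) b).
Qed.

Lemma gen_mul_std_basis i X : exists b : bool,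
  g i * std_basis g X = (-1) ^+ b * std_basis g (toggle i X).
Proof.
have [b] := prod_toggle i X (index_enum_uniq 'I_(s + t)).
by rewrite mem_index_enum expr1 => h; exists b.
Qed.

Definition symdiff (X Y : {set 'I_(s + t)}) : {set 'I_(s + t)} :=
  [set j | (j \in X) (+) (j \in Y)].

Lemma std_basis_mul X Y : exists b : bool,
  std_basis g X * std_basis g Y = (-1) ^+ b * std_basis g (symdiff X Y).
Proof.
have : exists b : bool, (\prod_(j <- enum X) g j) * std_basis g Y =
    (-1) ^+ b * std_basis g [set j | (j \in enum X) (+) (j \in Y)].
  elim: (enum X) (enum_uniq X) => [|i r IH] /=.
    exists false; rewrite big_nil !mul1r; congr std_basis.
    by apply/setP => j; rewrite inE.
  move=> /andP[ir ur]; have [b hb] := IH ur; rewrite big_cons -mulrA hb.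
  have [b' hb'] := gen_mul_std_basis i [set j | (j \in r) (+) (j \in Y)].
  exists (b (+) b'); rewrite mulrA (commr_sign (g i) b) -mulrA hb' mulrA signr_addb.
  congr (_ * std_basis g _); apply/setP => j; rewrite !inE.
  have [->|ji] := eqVneq j i; last by rewrite addbF.
  by rewrite (negbTE ir) addbT.
move=> [b hb]; exists b; rewrite std_basisE hb; congr (_ * std_basis g _).
by apply/setP => j; rewrite !inE mem_enum.
Qed.

Lemma std_basis0 : std_basis g finset.set0 = 1.
Proof. by rewrite /std_basis big_set0. Qed.

End CliffordSigns.

(** * Planar symmetric maps over an algebra *)

Lemma linear_forms_separate (R : fieldType) (V : vectType R) (u v : V) :
  (forall phi : {scalar V}, phi u = phi v) -> u = v.
Proof.
move=> h; rewrite (coord_vbasis (memvf u)) (coord_vbasis (memvf v)).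
by apply: eq_bigr => i _; congr (_ *: _); exact: (h (coord (vbasis fullv) i)).
Qed.

(* The difference tensor in coordinates: P(f) h = al f * h + C(f) h, where C(f)
   is O-linear and c i j f is the j-th coordinate of C(f) at the i-th basis
   vector. *)
Section PlanarDecomposition.
Variables (R : realType) (O : falgType R) (m : nat).
Hypothesis m1 : (1 < m)%N.
Hypothesis centralO : forall z : O,
  (forall a b c : O, (b * a - a * b) * (z * c - c * z) = 0) -> forall c, z * c = c * z.
Let T := {ffun 'I_m -> O}.
Variables (al : {linear T -> O}) (c : 'I_m -> 'I_m -> {linear T -> O}).
Hypothesis sym : forall (f h : T) j,
  \sum_i h i * c i j f + al f * h j = \sum_i f i * c i j h + al h * f j.
Hypothesis planar : forall f : T, exists g : O, forall j, \sum_i f i * c i j f = g * f j.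

Definition coord_vec (i : 'I_m) (b : O) : T := [ffun j => if j == i then b else 0].

Lemma coord_vec_linear i : linear (coord_vec i).
Proof.
by move=> a u v; apply/ffunP => j; rewrite !ffunE; case: eqP; rewrite // scaler0 addr0.
Qed.
HB.instance Definition _ i := GRing.isLinear.Build _ _ _ _ (coord_vec i) (coord_vec_linear i).

Lemma coord_vecE i b j : coord_vec i b j = if j == i then b else 0.
Proof. by rewrite ffunE. Qed.

Lemma sum_coord_vec (f : T) : f = \sum_i coord_vec i (f i).
Proof.
apply/ffunP => j; rewrite sum_ffunE (bigD1 j) //= coord_vecE eqxx big1 ?addr0 // => i ij.
by rewrite coord_vecE eq_sym (negbTE ij).
Qed.

Lemma sum_coord_vec_mul l b (G : 'I_m -> O) : \sum_i coord_vec l b i * G i = b * G l.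
Proof.
rewrite (bigD1 l) //= coord_vecE eqxx big1 ?addr0 // => i il.
by rewrite coord_vecE (negbTE il) mul0r.
Qed.

(** Polarization: planarity at f + h, f and h controls the sum of the two mixed terms, and [sym]
    their difference; each one is half of a combination of these. *)
Lemma planar2 (f h : T) : exists g d : O, forall j,
  \sum_i h i * c i j f = g * f j + d * h j.
Proof.
have [g1 h1] := planar (f + h); have [g2 h2] := planar f; have [g3 h3] := planar h.
exists (2^-1 *: (g1 - g2 + al h)), (2^-1 *: (g1 - g3 - al f)) => j.
have E : \sum_i (f + h) i * c i j (f + h) =
    (\sum_i f i * c i j f + \sum_i h i * c i j h) +
    (\sum_i h i * c i j f + \sum_i f i * c i j h).
  rewrite -!big_split; apply: eq_bigr => i _ /=.
  rewrite linearD ffunE mulrDl !mulrDr; apply: linear_forms_separate => phi.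
  by rewrite !(linearD phi); lra.
have e4 := h1 j; have e2 := h2 j; have e3 := h3 j; have e1 := sym f h j.
rewrite E e2 e3 ffunE in e4.
apply: linear_forms_separate => phi.
move: (congr1 phi e1) (congr1 phi e4).
rewrite -!scalerAl !mulrDl !mulrDr !mulNr !(linearD phi, linearN phi, linearZ_LR phi) /=.
lra.
Qed.

(** In slot j both vectors given to [planar2] vanish. *)
Lemma offdiag_eq0 l j i b : j != i -> j != l -> c l j (coord_vec i b) = 0.
Proof.
move=> ji jl; have [g [d /(_ j)]] := planar2 (coord_vec i b) (coord_vec l 1).
by rewrite sum_coord_vec_mul mul1r !coord_vecE (negbTE ji) (negbTE jl) !mulr0 addr0.
Qed.

Lemma offdiag_coord l j f : l != j -> c l j f = c l j (coord_vec j (f j)).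
Proof.
move=> lj; rewrite {1}(sum_coord_vec f) linear_sum (bigD1 j) //= big1 ?addr0 // => i ij.
by rewrite offdiag_eq0 // eq_sym.
Qed.

Lemma exchange_offdiag l j a b : l != j ->
  b * c l j (coord_vec j a) = a * c j j (coord_vec l b) + al (coord_vec l b) * a.
Proof.
move=> lj; have := sym (coord_vec j a) (coord_vec l b) j.
by rewrite !sum_coord_vec_mul !coord_vecE eqxx eq_sym (negbTE lj) mulr0 addr0.
Qed.

Lemma offdiagE l j a : l != j ->
  c l j (coord_vec j a) = a * c j j (coord_vec l 1) + al (coord_vec l 1) * a.
Proof. by move=> lj; have := exchange_offdiag a 1 lj; rewrite mul1r. Qed.

Lemma diagE l j b : l != j ->
  c j j (coord_vec l b) = b * (c j j (coord_vec l 1) + al (coord_vec l 1)) - al (coord_vec l b).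
Proof.
move=> lj; have := exchange_offdiag 1 b lj; rewrite offdiagE // !mul1r !mulr1 => ->.
by rewrite addrK.
Qed.

(* The left-hand side is a derivation in a, which forces the factor on the
   right-hand side to be central. *)
Lemma commutator_defect l j a b : l != j ->
  (al (coord_vec l b) - b * al (coord_vec l 1)) * a - a * (al (coord_vec l b) - b * al (coord_vec l 1)) =
  (b * a - a * b) * c j j (coord_vec l 1).
Proof.
move=> lj; have := exchange_offdiag a b lj; rewrite offdiagE // (diagE b lj).
move=> e; apply: linear_forms_separate => phi; move: (congr1 phi e).
rewrite !(mulrDl, mulrDr, mulNr, mulrN, mulrBl, mulrBr, mulrA, opprD, opprK).
rewrite !(linearD phi, linearN phi) /=. lra.
Qed.

Lemma diag1_central l j x : l != j -> c j j (coord_vec l 1) * x = x * c j j (coord_vec l 1).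
Proof.
move=> lj; apply: centralO => a b {}x.
set C := c j j (coord_vec l 1); pose D := al (coord_vec l b) - b * al (coord_vec l 1).
(* The Leibniz rule for the commutator with D on the product a * x, compared with the three
   right-hand sides, leaves (ba - ab)(Cx - xC) = 0. *)
have e0 := commutator_defect (a * x) b lj; have e1 := commutator_defect a b lj; have e2 := commutator_defect x b lj.
rewrite -/C -/D in e0 e1 e2.
have {}e1 := congr1 (fun y => y * x) e1; have {}e2 := congr1 (fun y => a * y) e2.
rewrite /= in e1 e2.
apply: linear_forms_separate => phi.
move: (congr1 phi e0) (congr1 phi e1) (congr1 phi e2).
rewrite !(mulrDl, mulrDr, mulNr, mulrN, mulrBl, mulrBr, mulrA, opprD, opprK).
rewrite !(linearD phi, linearN phi) /= linear0; lra.
Qed.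

(** By [diagE] the coefficient is bC - D with C central, and [commutator_defect] says that D and bC
    have the same commutator with x. *)
Lemma diag_central l j b x : l != j -> c j j (coord_vec l b) * x = x * c j j (coord_vec l b).
Proof.
move=> lj; have e0 := commutator_defect x b lj; have e1 := diag1_central x lj.
have {}e1 := congr1 (fun y => b * y) e1; rewrite /= in e1.
rewrite (diagE b lj); apply: linear_forms_separate => phi.
move: (congr1 phi e0) (congr1 phi e1).
rewrite !(mulrDl, mulrDr, mulNr, mulrN, mulrBl, mulrBr, mulrA, opprD, opprK).
rewrite !(linearD phi, linearN phi) /=; lra.
Qed.

(** In [planar2] for e_l and e_i + e_j, the components i and j both give the same factor d, as the
    off-diagonal terms vanish. *)
Lemma diag1_indep l i j : l != i -> l != j -> c i i (coord_vec l 1) = c j j (coord_vec l 1).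
Proof.
move=> li lj; have [->//|ij] := eqVneq i j.
have [g [d hd]] := planar2 (coord_vec l 1) (coord_vec i 1 + coord_vec j 1).
have e (k : 'I_m) : \sum_i0 (coord_vec i 1 + coord_vec j 1) i0 * c i0 k (coord_vec l 1) =
    c i k (coord_vec l 1) + c j k (coord_vec l 1).
  rewrite (eq_bigr (fun u => coord_vec i 1 u * c u k (coord_vec l 1) + coord_vec j 1 u * c u k (coord_vec l 1))).
    by rewrite big_split /= !sum_coord_vec_mul !mul1r.
  by move=> u _; rewrite ffunE mulrDl.
have ji : (j == i) = false by rewrite eq_sym (negbTE ij).
have il : (i == l) = false by rewrite eq_sym (negbTE li).
have jl : (j == l) = false by rewrite eq_sym (negbTE lj).
have := hd i; have := hd j; rewrite !e !ffunE !eqxx (negbTE ij) ji il jl !mulr0 !add0r addr0 !mulr1.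
rewrite (@offdiag_eq0 i j l) ?ji ?jl // (@offdiag_eq0 j i l) ?il ?ij //.
by rewrite add0r addr0 => -> ->.
Qed.

(** The place where rank at least 2 enters: the lemmas above need a second slot. *)
Lemma exists_neq (l : 'I_m) : exists j, l != j.
Proof.
have : (0 < #|predC1 l|)%N by rewrite cardC1 card_ord; case: (m) m1 => [|[]].
by move=> /card_gt0P [j]; rewrite inE /= => jl; exists j; rewrite eq_sym.
Qed.

Lemma planar_decomposition : exists p : {linear T -> O},
  (forall b (f : T), p [ffun i => b * f i] = b * p f) /\
  forall (f h : T) j, \sum_i h i * c i j f + al f * h j = p f * h j + p h * f j.
Proof.
have [k hk] := choice exists_neq.
(* For j other than l, the j-th component of P(e_l)e_j = p(e_l)e_j + p(e_j)e_l forces p(e_l) to be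
   this sum. Then z measures how far [al] is from p; its values are central. *)
pose q l := c (k l) (k l) (coord_vec l 1) + al (coord_vec l 1).
pose z l (a : O) := a * q l - al (coord_vec l a).
have F2 l j b : l != j -> c j j (coord_vec l b) = z l b.
  by move=> lj; rewrite (diagE b lj) (diag1_indep lj (hk l)).
have zC l b x : z l b * x = x * z l b.
  by rewrite -(F2 l (k l) b (hk l)); exact: diag_central (hk l).
have F1 l j a : l != j -> c l j (coord_vec j a) = q l * a.
  move=> lj; rewrite offdiagE // /q mulrDl; congr (_ + _).
  by rewrite (diag1_indep lj (hk l)) (diag1_central _ (hk l)).
have zE l a : z l a = a * q l - al (coord_vec l a) by [].
clearbody z; clearbody q.
(* The gap between the remaining coefficients, with all three indices equal, and the value q a +
   z(a) that the formula predicts for them. *)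
pose y l (a : O) := c l l (coord_vec l a) - q l * a - z l a.
have yD l a b : y l (a + b) = y l a + y l b.
  rewrite /y !zE (linearD (coord_vec l)) (linearD (c l l)) (linearD al) (mulrDr (q l)) (mulrDl a b).
  by apply: linear_forms_separate => phi; rewrite !(linearD phi, linearN phi) /=; lra.
(* Planarity at a e_l + e_j: component j gives the multiplier, which is then substituted in
   component l. *)
have key l j a : l != j -> a * y l a = y j 1 * a.
  move=> lj; have jl : j != l by rewrite eq_sym.
  have [g hg] := planar (coord_vec l a + coord_vec j 1).
  have e (i : 'I_m) : \sum_i0 (coord_vec l a + coord_vec j 1) i0 * c i0 i (coord_vec l a + coord_vec j 1) =
      a * (c l i (coord_vec l a) + c l i (coord_vec j 1)) + (c j i (coord_vec l a) + c j i (coord_vec j 1)).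
    rewrite (eq_bigr (fun u => coord_vec l a u * (c u i (coord_vec l a) + c u i (coord_vec j 1)) +
       coord_vec j 1 u * (c u i (coord_vec l a) + c u i (coord_vec j 1)))).
      by rewrite big_split /= !sum_coord_vec_mul !mul1r.
    by move=> u _; rewrite linearD ffunE mulrDl.
  have h1 := hg j; have h2 := hg l.
  rewrite !e !ffunE !eqxx (negbTE lj) (negbTE jl) !(addr0, add0r, mulr1) in h1 h2.
  rewrite (@offdiag_eq0 j l j) // in h2; rewrite (@offdiag_eq0 l j l) // add0r in h1.
  rewrite -h1 addr0 (F1 l j) // (F2 l j) // (F1 j l) // (F2 j l) // mulr1 in h2.
  have c1 := zC l a a; have c2 := zC j 1 a.
  move: h2; rewrite /y; move: (c l l _) (c j j _) => u v h2.
  apply: linear_forms_separate => phi.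
  move: (congr1 phi h2) (congr1 phi c1) (congr1 phi c2).
  rewrite !(mulrDl, mulrDr, mulNr, mulrN, mulrBl, mulrBr, mulrA, opprD, opprK, mulr1).
  rewrite !(linearD phi, linearN phi) /=; lra.
(* In [key] the left side is quadratic in a and the right side linear; replacing a by a + a makes
   both vanish. *)
have y1 l j a : l != j -> y j 1 * a = 0 /\ a * y l a = 0.
  move=> lj; have e1 := key l j a lj; have e2 := key l j (a + a) lj.
  rewrite yD in e2; suff e3 : y j 1 * a = 0 by rewrite e1 e3.
  apply: linear_forms_separate => phi; move: (congr1 phi e1) (congr1 phi e2).
  rewrite !(mulrDl, mulrDr) !(linearD phi) linear0; lra.
(* As a may be a zero divisor it is not cancelled: the relations for a and a + 1 are subtracted. *)
have y0 l a : y l a = 0.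
  have l1 : y l 1 = 0.
    by have := (y1 (k l) l 1); rewrite eq_sym => /(_ (hk l)) [+ _]; rewrite mulr1.
  have := (y1 l (k l) (a + 1) (hk l)).2; have := (y1 l (k l) a (hk l)).2.
  by rewrite yD l1 addr0 mulrDl mul1r => ->; rewrite add0r.
have F3 l a : c l l (coord_vec l a) = q l * a + z l a.
  by apply/eqP; rewrite -subr_eq0 opprD addrA; apply/eqP; exact: y0.
pose p0 (f : T) := \sum_l f l * q l.
have p0l : linear p0.
  move=> a u v; rewrite /p0 scaler_sumr -big_split; apply: eq_bigr => l _ /=.
  by rewrite !ffunE mulrDl scalerAl.
pose p : {linear T -> O} := HB.pack p0 (GRing.isLinear.Build _ _ _ _ p0 p0l).
have pE f : p f = \sum_l f l * q l by [].
clearbody p; exists p; split.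
  by move=> b f; rewrite !pE mulr_sumr; apply: eq_bigr => l _; rewrite ffunE mulrA.
move=> f h j.
pose zf := \sum_l z l (f l).
have zfE : zf = p f - al f.
  by rewrite pE {2}(sum_coord_vec f) linear_sum -sumrB; apply: eq_bigr => l _; rewrite zE.
have cd i : c i i f = q i * f i + zf.
  rewrite {1}(sum_coord_vec f) linear_sum (bigD1 i) //= F3 /zf [in RHS](bigD1 i) //= addrA.
  by congr (_ + _); apply: eq_bigr => l li; rewrite F2.
have co i : i != j -> c i j f = q i * f j by move=> ij; rewrite offdiag_coord // F1.
rewrite (bigD1 j) //= cd (eq_bigr (fun i => h i * q i * f j)); last first.
  by move=> i ij; rewrite co // mulrA.
rewrite -mulr_suml.
have zfC : h j * zf = zf * h j.
  rewrite /zf mulr_sumr mulr_suml; apply: eq_bigr => l _; by rewrite zC.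
have ph : p h = h j * q j + \sum_(i | i != j) h i * q i by rewrite pE (bigD1 j).
rewrite mulrDr zfC zfE ph; move: (\sum_(i | _) _) (p f) (al f) => S pf af.
apply: linear_forms_separate => phi.
rewrite !(mulrDl, mulNr, mulrA) !(linearD phi, linearN phi) /=; lra.
Qed.

End PlanarDecomposition.

(** * The standard basis of a Clifford algebra *)

Lemma sign_mulmx (R : pzRingType) n (b : nat) (M : 'M[R]_n) :
  (-1) ^+ b * M = (-1) ^+ b *: M.
Proof.
by rewrite -signr_odd -[in RHS]signr_odd; case: odd;
  rewrite ?expr1 ?expr0 ?scaleN1r ?scale1r ?mulN1r ?mul1r.
Qed.

Lemma memv_spanP (R : fieldType) (V : vectType R) (I : finType) (f : I -> V) v :
  v \in <<[seq f i | i <- enum I]>>%VS <-> exists c : I -> R, v = \sum_i c i *: f i.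
Proof.
split=> [|[c ->]]; last first.
  apply: rpred_sum => i _; apply/rpredZ/memv_span/map_f; exact: mem_enum.
rewrite span_def big_map big_enum /=.
move=> /memv_sumP [w wP ->].
have [c hc] : {c : I -> R & forall i, w i = c i *: f i}.
  apply: (@choice _ _ (fun i a => w i = a *: f i)) => i.
  by have /vlineP [a ->] := wP i isT; exists a.
by exists c; apply: eq_bigr => i _; exact: hc.
Qed.

Section CliffordAlg.
Variables (R : realType) (s t : nat) (O : clifford_algebra R s t).
Local Notation oF := (std_basis (@cl_gen R s t O)).
Local Notation hO := (@cl_genP R s t O).

Lemma cl_signZ (b : nat) (x : O) : (-1) ^+ b * x = (-1) ^+ b *: x.
Proof.
by rewrite -signr_odd -[in RHS]signr_odd; case: odd;
  rewrite ?expr1 ?expr0 ?scaleN1r ?scale1r ?mulN1r ?mul1r.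
Qed.

Lemma cl_basis_span : <<[seq oF X | X <- enum {set 'I_(s + t)}]>>%VS = @fullv R O.
Proof.
set W := <<_>>%VS; apply/eqP; rewrite eqEsubv subvf -(@cl_generated R s t O).
have memF X : oF X \in W by apply/memv_span/map_f; rewrite mem_enum.
apply: agenv_sub_modl.
  by rewrite -memvE -(std_basis0 (@cl_gen R s t O)).
apply/prodvP => u v /memv_spanP Hu /memv_spanP Hv.
have {Hu} [a ->] : exists c : 'I_(s + t) -> R, u = \sum_i c i *: cl_gen O i.
  exact: Hu.
move: Hv => [b ->]; rewrite mulr_suml; apply: rpred_sum => i _.
rewrite mulr_sumr; apply: rpred_sum => X _.
rewrite -scalerAl -scalerAr; apply/rpredZ/rpredZ.
have [e ->] := gen_mul_std_basis hO i X.
by rewrite cl_signZ; apply: rpredZ.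
Qed.

Lemma card_index : #|{set 'I_(s + t)}| = (2 ^ (s + t))%N.
Proof. by rewrite -cardsT -powersetT card_powerset cardsT card_ord. Qed.

(** The relations alone allow linear dependences, for instance when the product of all generators is
    a scalar; [cl_dim] excludes them by counting. *)
Lemma cl_basis_coord : exists cf : {set 'I_(s + t)} -> {scalar O},
  (forall a, a = \sum_X cf X a *: oF X) /\ (forall X Y, cf X (oF Y) = (X == Y)%:R).
Proof.
pose b := [tuple of [seq oF X | X <- enum {set 'I_(s + t)}]].
have bb : basis_of (@fullv R O) b.
  by rewrite basisEdim /= cl_basis_span subvv /= size_map -cardE card_index cl_dim.
have bX X : b`_(enum_rank X) = oF X.
  by rewrite (nth_map finset.set0) ?nth_enum_rank // -cardE ltn_ord.
exists (fun X => coord b (enum_rank X)); split.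
  move=> a; rewrite {1}(coord_basis bb (memvf a)) (reindex enum_rank) /=; last first.
    exact: onW_bij (@enum_rank_bij _).
  by apply: eq_bigr => X _; rewrite bX.
move=> X Y /=; rewrite -(bX Y) coord_free ?(basis_free bb) //.
by rewrite (inj_eq enum_rank_inj) eq_sym.
Qed.

(** Two distinct generators have the invertible commutator 2 g_j g_i, which can be cancelled. If
    there is only one generator, the algebra is commutative. *)
Lemma cl_centralP (z : O) :
  (forall a b c : O, (b * a - a * b) * (z * c - c * z) = 0) -> forall c, z * c = c * z.
Proof.
move=> h; have [cf [cfE _]] := cl_basis_coord.
have comm_gen i : z * cl_gen O i = cl_gen O i * z.
  have [[j ij]|nj] := pselect (exists j, j != i).
    have reg l (x : O) : cl_gen O l * x = 0 -> x = 0.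
      move=> e; have := congr1 (fun y => cl_gen O l * y) e.
      rewrite /= mulr0 mulrA hO.1; case: ifP => _; rewrite ?mul1r // mulN1r => /eqP.
      by rewrite oppr_eq0 => /eqP.
    have := h (cl_gen O i) (cl_gen O j) (cl_gen O i).
    have -> : cl_gen O i * cl_gen O j = - (cl_gen O j * cl_gen O i).
      by apply: hO.2; rewrite eq_sym.
    rewrite opprK mulrDl -mulr2n -scaler_nat => /eqP.
    rewrite scaler_eq0 pnatr_eq0 /= -mulrA => /eqP /reg /reg /eqP.
    by rewrite subr_eq0 => /eqP.
  have same j : j = i by apply: contrapT => ji; apply: nj; exists j; apply/eqP.
  rewrite (cfE z) mulr_suml mulr_sumr; apply: eq_bigr => X _.
  rewrite -scalerAl -scalerAr; congr (_ *: _); symmetry.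
  by apply: commr_prod => j _; rewrite (same j).
move=> c; rewrite (cfE c) mulr_suml mulr_sumr; apply: eq_bigr => X _.
rewrite -scalerAl -scalerAr; congr (_ *: _).
by apply: commr_prod => j _; exact: comm_gen.
Qed.

End CliffordAlg.

(** * The Casimir element *)

Definition bilinear_map (R : realType) (U W V : lmodType R) (be : U -> W -> V) : Prop :=
  (forall a, linear (be a)) /\ (forall b, linear (be^~ b)).

Section Bilinear.
Variables (R : realType) (U W V : lmodType R) (be : U -> W -> V).
Hypothesis hbe : bilinear_map be.

Definition bilL a : {linear W -> V} :=
  HB.pack (be a) (GRing.isLinear.Build _ _ _ _ (be a) (hbe.1 a)).
Definition bilR b : {linear U -> V} :=
  HB.pack (be^~ b) (GRing.isLinear.Build _ _ _ _ (be^~ b) (hbe.2 b)).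

Lemma bil_Zr a k b : be a (k *: b) = k *: be a b.
Proof. exact: (linearZ_LR (bilL a)). Qed.
Lemma bil_Zl a k b : be (k *: a) b = k *: be a b.
Proof. exact: (linearZ_LR (bilR b)). Qed.
Lemma bil_sumr a I r (P : pred I) (b : I -> W) :
  be a (\sum_(i <- r | P i) b i) = \sum_(i <- r | P i) be a (b i).
Proof. exact: (linear_sum (bilL a)). Qed.
Lemma bil_suml b I r (P : pred I) (a : I -> U) :
  be (\sum_(i <- r | P i) a i) b = \sum_(i <- r | P i) be (a i) b.
Proof. exact: (linear_sum (bilR b)). Qed.

End Bilinear.

Section Casimir.
Variables (R : realType) (n s t : nat) (g : 'I_(s + t) -> 'M[R]_n).
Hypothesis hg : clifford_gens g.
Local Notation F := (std_basis g).
Local Notation eps := (cl_sign R).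

Lemma std_basis_sqmx X : F X *m F X = eps X *: 1%:M.
Proof.
have := std_basis_sq hg X; rewrite -[RHS]mulr1 => e.
by rewrite -[LHS]/(F X * F X) e sign_mulmx.
Qed.

(** An identity in the tensor square of the matrix algebra, stated by evaluating all bilinear
    maps. *)
Definition casimir (a : 'M[R]_n) : Prop :=
  forall (V : lmodType R) (be : 'M[R]_n -> 'M[R]_n -> V), bilinear_map be ->
    \sum_X eps X *: be (a *m F X) (F X) = \sum_X eps X *: be (F X) (F X *m a).

(** The terms agree one by one after reindexing by [toggle i]. The scalar relating F_(toggle i X)
    g_i to F_X is found by multiplying on the right by F_X F_X = eps_X. *)
Lemma casimir_gen i : casimir (g i).
Proof.
move=> V be hbe.
rewrite [RHS](reindex_inj (inv_inj (toggleK i))) /=; apply: eq_bigr => X _.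
have [b hb] := gen_mul_std_basis hg i X; rewrite sign_mulmx in hb.
have e : F (toggle i X) *m g i = (eps X * (-1) ^+ b * eps (toggle i X)) *: F X.
  have h : F (toggle i X) *m g i *m (F X *m F X) = ((-1) ^+ b * eps (toggle i X)) *: F X.
    rewrite mulmxA -(mulmxA _ (g i)) -[g i *m F X]/(g i * F X) hb.
    by rewrite -scalemxAr std_basis_sqmx scalerA -scalemxAl mul1mx.
  rewrite std_basis_sqmx -scalemxAr mulmx1 in h.
  by rewrite -mulrA -scalerA -h scalerA cl_sign_sq scale1r.
rewrite -[g i *m F X]/(g i * F X) hb e (bil_Zl hbe) (bil_Zr hbe) !scalerA.
congr (_ *: _); have := cl_sign_sq R (toggle i X).
move: (eps X) (eps _) ((-1) ^+ b) => a c d h.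
by rewrite (_ : c * (a * d * c) = a * d * (c * c)); [rewrite h mulr1|ring].
Qed.

Lemma casimirM a b : casimir a -> casimir b -> casimir (a *m b).
Proof.
move=> ca cb V be hbe.
transitivity (\sum_X eps X *: be (a *m F X) (F X *m b)).
  rewrite -(cb _ (fun x y => be (a *m x) y)); first by under eq_bigr do rewrite -mulmxA.
  split=> [c|c] k u v; first exact: hbe.1.
  by rewrite mulmxDr -scalemxAr; exact: hbe.2.
rewrite (ca _ (fun x y => be x (y *m b))); first by under eq_bigr do rewrite -mulmxA.
split=> [c|c] k u v; last exact: hbe.2.
by rewrite mulmxDl -scalemxAl; exact: hbe.1.
Qed.

Lemma casimir1 : casimir 1%:M.
Proof. by move=> V be _; under eq_bigr do rewrite mul1mx -[X in be _ X]mulmx1. Qed.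

Lemma casimir_lin (I : Type) (r : seq I) (k : I -> R) (a : I -> 'M[R]_n) :
  (forall i, casimir (a i)) -> casimir (\sum_(i <- r) k i *: a i).
Proof.
move=> ha V be hbe.
transitivity (\sum_(i <- r) k i *: \sum_X eps X *: be (a i *m F X) (F X)).
  under [RHS]eq_bigr do rewrite scaler_sumr.
  rewrite exchange_big; apply: eq_bigr => X _ /=.
  rewrite mulmx_suml (bil_suml hbe) scaler_sumr; apply: eq_bigr => i _.
  by rewrite -scalemxAl (bil_Zl hbe) !scalerA mulrC.
under eq_bigr do rewrite (ha _ _ _ hbe) scaler_sumr.
rewrite exchange_big; apply: eq_bigr => X _ /=.
rewrite mulmx_sumr (bil_sumr hbe) scaler_sumr; apply: eq_bigr => i _.
by rewrite -scalemxAr (bil_Zr hbe) !scalerA mulrC.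
Qed.

Lemma casimir_std X : casimir (F X).
Proof.
rewrite /std_basis; apply: (big_ind casimir); first exact: casimir1.
  by move=> a b; exact: casimirM.
by move=> i _; exact: casimir_gen.
Qed.

Lemma casimir_span a : a \in <<[seq F X | X <- enum {set 'I_(s + t)}]>>%VS -> casimir a.
Proof. by move=> /memv_spanP [c ->]; apply: casimir_lin => X; exact: casimir_std. Qed.

Lemma span_mul a b : a \in <<[seq F X | X <- enum {set 'I_(s + t)}]>>%VS ->
  b \in <<[seq F X | X <- enum {set 'I_(s + t)}]>>%VS ->
  a *m b \in <<[seq F X | X <- enum {set 'I_(s + t)}]>>%VS.
Proof.
move=> /memv_spanP [c ->] /memv_spanP [d ->].
rewrite mulmx_suml; apply: rpred_sum => X _.
rewrite mulmx_sumr; apply: rpred_sum => Y _.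
rewrite -scalemxAl -scalemxAr; apply/rpredZ/rpredZ.
have [e he] := std_basis_mul hg X Y; rewrite sign_mulmx in he.
rewrite -[_ *m _]/(F X * F Y) he; apply/rpredZ/memv_span/map_f.
by rewrite mem_enum.
Qed.

End Casimir.

(* Both sides are computed from the double sum of
   eps_X eps_Y be (F_X F'_Y) (F'_Y F_X). *)
Lemma casimir_indep (R : realType) (n s t : nat) (g g' : 'I_(s + t) -> 'M[R]_n)
    (V : lmodType R) (be : 'M[R]_n -> 'M[R]_n -> V) :
  clifford_gens g -> clifford_gens g' ->
  <<[seq std_basis g X | X <- enum {set 'I_(s + t)}]>>%VS =
    <<[seq std_basis g' X | X <- enum {set 'I_(s + t)}]>>%VS ->
  bilinear_map be ->
  \sum_X cl_sign R X *: be (std_basis g X) (std_basis g X) =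
  \sum_X cl_sign R X *: be (std_basis g' X) (std_basis g' X).
Proof.
move=> hg hg' eA hbe.
set k := #|{set 'I_(s + t)}|.
have k0 : k%:R != 0 :> R.
  by rewrite pnatr_eq0 -lt0n; apply/card_gt0P; exists finset.set0.
apply: (scalerI k0).
transitivity (\sum_X \sum_Y (cl_sign R X * cl_sign R Y) *:
    be (std_basis g X *m std_basis g' Y) (std_basis g' Y *m std_basis g X)).
  rewrite exchange_big /= scaler_nat -sumr_const; apply: eq_bigr => Y _.
  have memY : std_basis g' Y \in <<[seq std_basis g X | X <- enum {set 'I_(s + t)}]>>%VS.
    by rewrite eA; apply/memv_span/map_f; rewrite mem_enum.
  have h : bilinear_map (fun x y => be y (std_basis g' Y *m x)).
    split=> [c|c] r u v; first exact: hbe.2.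
    by rewrite mulmxDr -scalemxAr; exact: hbe.1.
  under [RHS]eq_bigr do rewrite mulrC -scalerA.
  rewrite -scaler_sumr -(casimir_span hg memY h).
  under [in RHS]eq_bigr do rewrite mulmxA std_basis_sqmx // -scalemxAl mul1mx (bil_Zr hbe) scalerA mulrC -scalerA.
  by rewrite -scaler_sumr scalerA cl_sign_sq scale1r.
rewrite scaler_nat -sumr_const; apply: eq_bigr => X _.
have memX : std_basis g X \in <<[seq std_basis g' X | X <- enum {set 'I_(s + t)}]>>%VS.
  by rewrite -eA; apply/memv_span/map_f; rewrite mem_enum.
have h : bilinear_map (fun x y => be x (y *m std_basis g X)).
  split=> [c|c] r u v; last exact: hbe.2.
  by rewrite mulmxDl -scalemxAl; exact: hbe.1.
under eq_bigr do rewrite -scalerA.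
rewrite -scaler_sumr (casimir_span hg' memX h).
under [in LHS]eq_bigr do rewrite -mulmxA std_basis_sqmx // -scalemxAr mulmx1 (bil_Zr hbe) scalerA mulrC -scalerA.
by rewrite -scaler_sumr scalerA cl_sign_sq scale1r.
Qed.

Lemma trace_dual (R : realType) n (I : finType) (b : I -> 'cV[R]_n)
    (phi : I -> {scalar 'cV[R]_n}) (M : 'M[R]_n) :
  (forall v, v = \sum_p phi p v *: b p) -> \tr M = \sum_p phi p (M *m b p).
Proof.
move=> h; rewrite /mxtrace.
have e j : M j j = \sum_p phi p (delta_mx j 0) * (M *m b p) j 0.
  have := congr1 (fun v => (M *m v) j 0) (h (delta_mx j 0)).
  rewrite -colE mxE => ->; rewrite mulmx_sumr summxE; apply: eq_bigr => p _.
  by rewrite -scalemxAr mxE.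
under eq_bigr do rewrite e; rewrite exchange_big; apply: eq_bigr => p _ /=.
have -> : M *m b p = \sum_j (M *m b p) j 0 *: delta_mx j 0.
  by rewrite {1}[M *m b p]matrix_sum_delta; apply: eq_bigr => j _; rewrite big_ord1.
rewrite linear_sum; apply: eq_bigr => j _ /=; rewrite linearZ /= mulrC; congr (_ * _).
rewrite summxE (bigD1 j) //= big1 => [|l lj]; first by rewrite !mxE !eqxx mulr1 addr0.
by rewrite !mxE eq_sym (negbTE lj) mulr0.
Qed.

Lemma col_sum_delta (R : pzRingType) n (u : 'cV[R]_n) : u = \sum_j u j 0 *: delta_mx j 0.
Proof.
by rewrite {1}[u]matrix_sum_delta; apply: eq_bigr => j _; rewrite big_ord1.
Qed.

Lemma mx_eq_mulmx (R : pzRingType) m n (A B : 'M[R]_(m, n)) :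
  (forall v : 'cV_n, A *m v = B *m v) -> A = B.
Proof.
by move=> h; apply/matrixP => i j; have := congr1 (fun v : 'cV_m => v i 0) (h (delta_mx j 0));
  rewrite -!colE !mxE.
Qed.

(** * The correction term, its trace and its pointwise characterization *)

Section OdotSum.
Variables (R : realType) (n s t : nat) (g : 'I_(s + t) -> 'M[R]_n).

(** The correction as a matrix acting on the second argument, in the format of connection matrices;
    the rank-one products are the swapped halves of [odot]. *)
Definition odot_sum (Y : 'rV[R]_n) (u : 'cV[R]_n) : 'M[R]_n :=
  \sum_X cl_sign R X *: (eval_form (Y *m std_basis g X) u *: std_basis g X
    + (std_basis g X *m u) *m (Y *m std_basis g X)).

Lemma odot_sumE Y u v : odot_sum Y u *m v =
  \sum_X cl_sign R X *: odot (Y *m std_basis g X) (std_basis g X) u v.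
Proof.
rewrite mulmx_suml; apply: eq_bigr => X _.
rewrite -scalemxAl mulmxDl -scalemxAl /odot; congr (_ *: (_ + _)).
by rewrite -(mulmxA (std_basis g X *m u)) [Y *m _ *m v]mx11_scalar mul_mx_scalar.
Qed.

End OdotSum.

Section Model.
Variables (R : realType) (s t m n : nat) (O : clifford_algebra R s t).
Variables (g : 'I_(s + t) -> 'M[R]_n) (theta : {linear 'cV[R]_n -> {ffun 'I_m -> O}}).
Hypothesis hg : clifford_gens g.
Hypothesis btheta : bijective theta.
Hypothesis thetaF : forall X v a,
  theta (std_basis g X *m v) a = std_basis (@cl_gen R s t O) X * theta v a.
Local Notation F := (std_basis g).
Local Notation oF := (std_basis (@cl_gen R s t O)).
Local Notation eps := (cl_sign R).
Local Notation A := (<<[seq std_basis g X | X <- enum {set 'I_(s + t)}]>>%VS).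

Lemma theta_inv : exists ti : {linear {ffun 'I_m -> O} -> 'cV[R]_n},
  cancel theta ti /\ cancel ti theta.
Proof.
have [ti K1 K2] := btheta.
have l : linear ti by move=> a u v; apply: (bij_inj btheta); rewrite linearP !K2.
pose L : {linear {ffun 'I_m -> O} -> 'cV[R]_n} :=
  HB.pack ti (GRing.isLinear.Build _ _ _ _ ti l).
by exists L.
Qed.

Lemma symdiff_neq (X Y : {set 'I_(s + t)}) : X != finset.set0 -> symdiff X Y != Y.
Proof.
apply: contraNN => /eqP e; apply/eqP/setP => j.
have := congr1 (fun Z : {set _} => j \in Z) e; rewrite /= !inE.
by case: (j \in X); case: (j \in Y).
Qed.

(* F_X permutes the real basis F_Y e_i up to sign, without fixed vectors. *)
Lemma trace_std X : X != finset.set0 -> \tr (F X) = 0.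
Proof.
move=> X0; have [cf [cfE cfF]] := cl_basis_coord O.
have [ti [K1 K2]] := theta_inv.
pose b (p : {set 'I_(s + t)} * 'I_m) := ti (coord_vec p.2 (oF p.1)).
have phil (p : {set 'I_(s + t)} * 'I_m) : scalar (fun v => cf p.1 (theta v p.2)).
  by move=> a u v; rewrite linearP !ffunE linearP.
pose phi (p : {set 'I_(s + t)} * 'I_m) : {scalar 'cV[R]_n} :=
  HB.pack (fun v => cf p.1 (theta v p.2)) (GRing.isLinear.Build _ _ _ _ _ (phil p)).
rewrite (@trace_dual _ _ _ b phi).
  rewrite big1 // => -[Y i] _; rewrite /phi /b /= thetaF K2 coord_vecE eqxx.
  have [e ->] := std_basis_mul (@cl_genP R s t O) X Y.
  by rewrite cl_signZ linearZ /= cfF eq_sym (negbTE (symdiff_neq _ X0)) mulr0.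
move=> v; apply: (bij_inj btheta); apply/ffunP => j; rewrite linear_sum sum_ffunE.
rewrite -(pair_bigA _ (fun Y i => theta (phi (Y, i) v *: b (Y, i)) j)) /=.
rewrite {1}(cfE (theta v j)); apply: eq_bigr => Y _.
rewrite (bigD1 j) //= big1 => [|i ij].
  by rewrite linearZ /= !ffunE K2 coord_vecE eqxx addr0.
by rewrite linearZ /= !ffunE K2 coord_vecE eq_sym (negbTE ij) scaler0.
Qed.

(** Only the unit among the F_X has nonzero trace, which yields n; each rank-one term has trace
    Upsilon(F_X F_X u) = eps_X Upsilon(u), and its sign eps_X turns this into Upsilon(u), once for
    every X. *)
Lemma trace_odot_sum Y u :
  \tr (odot_sum g Y u) = (n%:R + (2 ^ (s + t))%:R) * eval_form Y u.
Proof.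
rewrite /odot_sum linear_sum /=.
transitivity (\sum_X (eps X * eval_form (Y *m F X) u * \tr (F X) + eval_form Y u)).
  apply: eq_bigr => X _; rewrite linearZ linearD linearZ /= mulrDr mulrA; congr (_ + _).
  rewrite mxtrace_mulC -(mulmxA Y) (mulmxA (F X)) std_basis_sqmx // -scalemxAl mul1mx.
  rewrite -scalemxAr linearZ /= mulrA cl_sign_sq mul1r.
  by rewrite /mxtrace big_ord1.
rewrite big_split /= (bigD1 finset.set0) //= big1 => [|X X0]; last first.
  by rewrite trace_std ?mulr0.
have eps0 : eps finset.set0 = 1 by exact: cl_sign0.
rewrite std_basis0 mulmx1 eps0 mul1r mxtrace1 addr0 sumr_const card_index mulrDl.
by rewrite mulrC -[_ *+ (2 ^ _)]mulr_natl.
Qed.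

Section Pointwise.
Hypothesis m1 : (1 < m)%N.
Variable P : {linear 'cV[R]_n -> 'M[R]_n}.
Hypothesis Psym : forall u v, P u *m v = P v *m u.
Hypothesis Pplanar : forall u, exists2 a, a \in A & P u *m u = a *m u.
Hypothesis Pnorm : forall u a, a \in A -> P u *m a - a *m P u \in A.

Lemma mem_A_theta a : a \in A -> exists b : O, forall v i, theta (a *m v) i = b * theta v i.
Proof.
move=> /memv_spanP [c ->]; exists (\sum_X c X *: oF X) => v i.
rewrite mulmx_suml linear_sum sum_ffunE mulr_suml; apply: eq_bigr => X _.
by rewrite -scalemxAl linearZ ffunE thetaF scalerAl.
Qed.

Lemma pointwise_form : exists Y : 'rV[R]_n, forall u, P u = odot_sum g Y u.
Proof.
have [cf [cfE cfF]] := cl_basis_coord O.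
have [ti [K1 K2]] := theta_inv.
pose k : R := #|{set 'I_(s + t)}|%:R.
have k0 : k != 0 by rewrite pnatr_eq0 -lt0n; apply/card_gt0P; exists finset.set0.
have memF X : F X \in A by apply/memv_span/map_f; rewrite mem_enum.
pose C0 u : 'M[R]_n := \sum_X (k^-1 * eps X) *: (F X *m P u *m F X).
have C0E u : C0 u = k^-1 *: \sum_X eps X *: (F X *m P u *m F X).
  by rewrite scaler_sumr; apply: eq_bigr => X _; rewrite scalerA.
have C0l : linear C0.
  move=> a u v; rewrite /C0 scaler_sumr -big_split; apply: eq_bigr => X _ /=.
  by rewrite linearP mulmxDr mulmxDl -scalemxAr -scalemxAl scalerDr !scalerA mulrC.
pose C : {linear 'cV[R]_n -> 'M[R]_n} := HB.pack C0 (GRing.isLinear.Build _ _ _ _ C0 C0l).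
have CA u a : a \in A -> C u *m a = a *m C u.
  move=> aA; rewrite /C /= C0E -scalemxAl -scalemxAr; congr (_ *: _).
  have h : bilinear_map (fun x y : 'M[R]_n => x *m P u *m y).
    split=> [c|c] r x y; first by rewrite mulmxDr -scalemxAr.
    by rewrite !mulmxDl -!scalemxAl.
  have e := casimir_span hg aA h; rewrite mulmx_suml mulmx_sumr.
  transitivity (\sum_X eps X *: (F X *m P u *m (F X *m a))).
    by apply: eq_bigr => X _; rewrite -scalemxAl !mulmxA.
  by rewrite -e; apply: eq_bigr => X _; rewrite -scalemxAr !mulmxA.
have DA u : P u - C u \in A.
  (* As F_X F_X = eps_X, the matrix P u is the average of the eps_X P u F_X F_X; the difference is
     then a combination of commutators, which [Pnorm] puts in A. *)
  have -> : P u - C u = \sum_X (k^-1 * eps X) *: ((P u *m F X - F X *m P u) *m F X).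
    have {1}-> : P u = \sum_X (k^-1 * eps X) *: (P u *m F X *m F X).
      under eq_bigr do rewrite -mulmxA std_basis_sqmx // -scalemxAr mulmx1 scalerA -mulrA cl_sign_sq mulr1.
      by rewrite sumr_const -scaler_nat scalerA divff // scale1r.
    rewrite /C /= /C0 -sumrB; apply: eq_bigr => X _.
    by rewrite mulmxBl scalerBr.
  apply: rpred_sum => X _; apply: rpredZ; apply: span_mul => //.
  exact: Pnorm.
clearbody C; clear C0 C0E C0l.
pose i0 : 'I_m := Ordinal (ltnW m1).
(* An element of A acts as left multiplication by one element of O; its value on the vector with 1
   in slot [i0] reads that element off. *)
pose al0 (f : {ffun 'I_m -> O}) : O := theta ((P (ti f) - C (ti f)) *m ti (coord_vec i0 1)) i0.
have al0l : linear al0.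
  move=> a u v; rewrite /al0 (linearP ti) (linearP P) (linearP C) opprD addrACA -scalerBr mulmxDl.
  by rewrite -scalemxAl (linearP theta) !ffunE.
pose al : {linear {ffun 'I_m -> O} -> O} := HB.pack al0 (GRing.isLinear.Build _ _ _ _ al0 al0l).
have alE f v i : theta ((P (ti f) - C (ti f)) *m v) i = al f * theta v i.
  have [b hb] := mem_A_theta (DA (ti f)).
  by rewrite hb /al /= /al0 hb K2 coord_vecE eqxx mulr1.
pose c0 i j (f : {ffun 'I_m -> O}) : O := theta (C (ti f) *m ti (coord_vec i 1)) j.
have c0l i j : linear (c0 i j).
  move=> a u v; rewrite /c0 (linearP ti) (linearP C) mulmxDl -scalemxAl.
  by rewrite (linearP theta) !ffunE.
pose c i j : {linear {ffun 'I_m -> O} -> O} :=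
  HB.pack (c0 i j) (GRing.isLinear.Build _ _ _ _ (c0 i j) (c0l i j)).
pose rho (b : O) : 'M[R]_n := \sum_X cf X b *: F X.
have rhoA b : rho b \in A by apply: rpred_sum => X _; apply: rpredZ.
have rhoE b v i : theta (rho b *m v) i = b * theta v i.
  rewrite {2}(cfE b) mulmx_suml linear_sum sum_ffunE mulr_suml; apply: eq_bigr => X _.
  by rewrite -scalemxAl linearZ ffunE thetaF scalerAl.
have vE v : v = \sum_i rho (theta v i) *m ti (coord_vec i 1).
  apply: (bij_inj btheta); apply/ffunP => j; rewrite linear_sum sum_ffunE (bigD1 j) //=.
  rewrite rhoE K2 coord_vecE eqxx mulr1 big1 ?addr0 // => i ij.
  by rewrite rhoE K2 coord_vecE eq_sym (negbTE ij) mulr0.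
have CE f v j : theta (C (ti f) *m v) j = \sum_i theta v i * c i j f.
  rewrite {1}(vE v) mulmx_sumr linear_sum sum_ffunE; apply: eq_bigr => i _.
  by rewrite mulmxA CA // -mulmxA rhoE.
have PE f h j : theta (P (ti f) *m ti h) j = \sum_i h i * c i j f + al f * h j.
  rewrite -{1}(subrK (C (ti f)) (P (ti f))) mulmxDl linearD ffunE alE CE K2.
  by rewrite addrC.
have [f h j||p [pM pE]] := @planar_decomposition R O m m1 (@cl_centralP R s t O) al c.
- by rewrite -!PE Psym.
- move=> f; have [a aA ha] := Pplanar (ti f).
  have [b hb] := mem_A_theta aA.
  exists (b - al f) => j; have := PE f f j; rewrite ha hb K2 mulrBl => ->.
  by rewrite addrK.
pose Y : 'rV[R]_n := \row_j cf finset.set0 (p (theta (delta_mx j 0))).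
have YE u : eval_form Y u = cf finset.set0 (p (theta u)).
  rewrite {2}(col_sum_delta u) !linear_sum /eval_form mxE /=.
  by apply: eq_bigr => j _; rewrite mxE !linearZ /= mulrC.
have cfX X b : cf X b = eps X * cf finset.set0 (oF X * b).
  rewrite {2}(cfE b) mulr_sumr linear_sum (bigD1 X) //= big1 => [|Z ZX].
    have sq : oF X * oF X = eps X *: oF finset.set0.
      by rewrite (std_basis_sq (@cl_genP R s t O)) -[LHS]mulr1 cl_signZ std_basis0.
    rewrite -scalerAr sq linearZ /= linearZ /= cfF eqxx.
    by rewrite mulr1 addr0 mulrCA cl_sign_sq mulr1.
  rewrite -scalerAr linearZ /=; have [e ->] := std_basis_mul (@cl_genP R s t O) X Z.
  rewrite cl_signZ linearZ /= cfF [_ == _](_ : _ = false) ?mulr0 //.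
  apply: contraNF ZX => /eqP e0; apply/eqP/setP => j.
  have := congr1 (fun S : {set _} => j \in S) e0; rewrite /= !inE.
  by case: (j \in X); case: (j \in Z).
have pF X u : p (theta (F X *m u)) = oF X * p (theta u).
  by rewrite -pM; congr (p _); apply/ffunP => i; rewrite ffunE thetaF.
have evF X u : eval_form (Y *m F X) u = cf finset.set0 (oF X * p (theta u)).
  by rewrite -pF -YE /eval_form mulmxA.
exists Y => u; apply: mx_eq_mulmx => v; apply: (bij_inj btheta); apply/ffunP => j.
rewrite -{1}(K1 u) -{1}(K1 v) PE pE odot_sumE linear_sum sum_ffunE.
rewrite {1}(cfE (p (theta u))) {1}(cfE (p (theta v))) !mulr_suml -big_split.
apply: eq_bigr => X _ /=.
rewrite linearZ ffunE linearD ffunE !linearZ !ffunE !thetaF !evF.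
by rewrite scalerDr !scalerA -!cfX -!scalerAl.
Qed.

End Pointwise.
End Model.

(** * Connections on manifolds *)

Section SecondDerivative.
Variables (R : realType) (n m : nat).

(** Change of chart for accelerations: the last term is the second derivative of the transition map
    that also occurs in the transformation law of connections. *)
Lemma derive2_comp (I : set R) (U : set 'cV[R]_n) (q : R -> 'cV[R]_n)
    (tau : 'cV[R]_n -> 'cV[R]_m) (r : R) :
  open I -> open U -> I r -> (forall t, I t -> U (q t)) ->
  Ck_on 2 I q -> Ck_on 2 U tau ->
  'D_1 (tau \o q) r = 'D_('D_1 q r) tau (q r) /\
  'D_1 ('D_1 (tau \o q)) r = 'D_('D_1 ('D_1 q) r) tau (q r) +
     'D_('D_1 q r) ('D_('D_1 q r) tau) (q r).
Proof.
move=> oI oU Ir IU Cq Ct.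
have [x [xE cx]] := coordinates_cV R n.
pose e (i : 'I_n) := delta_mx i 0 : 'cV[R]_n.
have Ct1 : Ck_on 1 U tau := Ck_on_pred Ct.
have Dt y : U y -> differentiable tau y := C1_differentiable cx oU Ct1.
have Cte i : Ck_on 1 U ('D_(e i) tau) := Ck_on_derive (e i) Ct.
have Dte i y : U y -> differentiable ('D_(e i) tau) y := C1_differentiable cx oU (Cte i).
have dq t : I t -> derivable q t 1 by move=> It; exact: (@Ck_on_derivable R R 'cV[R]_n 1 I q 1 t Cq It).
have dq2 t : I t -> derivable ('D_1 q) t 1.
  move=> It; have C1 := @Ck_on_derive R R 'cV[R]_n 1 I q 1 Cq.
  exact: (@Ck_on_derivable R R 'cV[R]_n 0 I _ 1 t C1 It).
have D1 t : I t -> 'D_1 (tau \o q) t = 'D_('D_1 q t) tau (q t).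
  move=> It; have [_ ->] := derive_comp (Dt _ (IU t It)) (dq t It).
  by rewrite (deriveE _ (Dt _ (IU t It))).
split; first exact: D1.
have D1' t : I t -> 'D_1 (tau \o q) t = \sum_i ('D_1 q t) i 0 *: 'D_(e i) tau (q t).
  move=> It; rewrite D1 // (derive_coord cx oU _ Ct1 (IU t It)).
  by apply: eq_bigr => i _; rewrite xE.
have -> : 'D_1 ('D_1 (tau \o q)) r =
    'D_1 (\sum_(i < n) (fun t => ('D_1 q t) i 0 *: ('D_(e i) tau \o q) t)) r.
  apply: near_eq_derive; apply: filterS (open_nbhs_nbhs (conj oI Ir)) => t It.
  by rewrite D1' // fct_sumE.
have dsc i : derivable (fun t => ('D_1 q t) i 0) r 1.
  exact: ((derivable_mxP ('D_1 q) r 1).1 (dq2 r Ir) i 0).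
have dc i := derive_comp (Dte i _ (IU r Ir)) (dq r Ir).
have dsd i := derive_scale (dsc i) (dc i).1.
rewrite (derive_sum (fun i => (dsd i).1)).
under eq_bigr do rewrite (dsd _).2 (dc _).2.
rewrite big_split; congr (_ + _) => /=.
  rewrite (derive_coord cx oU _ Ct1 (IU r Ir)); apply: eq_bigr => i _.
  by rewrite xE (derive_mx (dq2 r Ir)) mxE.
set v := 'D_1 q r.
have -> : 'D_v ('D_v tau) (q r) = 'D_v (\sum_(i < n) (v i 0 *: 'D_(e i) tau)) (q r).
  apply: near_eq_derive; apply: filterS (open_nbhs_nbhs (conj oU (IU r Ir))) => y Uy.
  rewrite (derive_coord cx oU _ Ct1 Uy) fct_sumE.
  by apply: eq_bigr => i _; rewrite xE.
have dd i : derivable ('D_(e i) tau) (q r) v.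
  by exact: Ck_on_derivable (Cte i) (IU r Ir).
have ddz i : derivable (v i 0 *: 'D_(e i) tau) (q r) v by apply: derivableZ; exact: dd.
rewrite (derive_sum ddz).
by apply: eq_bigr => i _; rewrite (deriveZ _ (dd i)) (deriveE _ (Dte i _ (IU r Ir))).
Qed.

End SecondDerivative.

Section Manifold.
Variables (R : realType) (n : nat) (M : manifold R n).
Implicit Types (c d : chart M) (x : M).

Lemma image_chart_open c (W : set M) : open W -> W `<=` cdom c -> open (cmap c @` W).
Proof.
move=> oW Wc; rewrite openE => p [x Wx <-].
have Cp : (cmap c @` cdom c) (cmap c x) by exists x => //; exact: Wc.
have cc := cinv_continuous Cp; rewrite /prop_for /continuous_at cmapK in cc; last exact: Wc.
have nW : nbhs (cmap c x) (cinv c @^-1` W) := cc W (open_nbhs_nbhs (conj oW Wx)).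
have nC := open_nbhs_nbhs (conj (@cimage_open _ _ M c) Cp).
apply: filterS (filterI nW nC) => z [/= Wz [y cy yz]].
by exists y => //; move: Wz; rewrite -yz cmapK.
Qed.

Lemma overlap_open c d : open (cmap c @` (cdom c `&` cdom d)).
Proof.
apply: image_chart_open; last exact: subIsetl.
by apply: openI; exact: cdom_open.
Qed.

Lemma transitionE c d x : cdom c x -> transition c d (cmap c x) = cmap d x.
Proof. by move=> cx; rewrite /transition /= cmapK. Qed.

Lemma transition_diff c d x : cdom c x -> cdom d x ->
  differentiable (transition c d) (cmap c x).
Proof.
move=> cx dx; have [y [_ cy]] := coordinates_cV R n.
have Ct : Ck_on 1 (cmap c @` (cdom c `&` cdom d)) (transition c d).
  exact: (@transition_smooth _ _ M c d 1%N).
have Ux : (cmap c @` (cdom c `&` cdom d)) (cmap c x) by exists x.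
exact: (C1_differentiable cy (@overlap_open c d) Ct Ux).
Qed.

Lemma dtransK c d x u : cdom c x -> cdom d x -> dtrans d c x (dtrans c d x u) = u.
Proof.
move=> cx dx; rewrite /dtrans -(deriveE _ (transition_diff dx cx)) -(transitionE d cx).
have d1 := transition_diff cx dx.
have d2 : differentiable (transition d c) (transition c d (cmap c x)).
  by rewrite transitionE //; exact: transition_diff.
have [_ e] := @derive_comp R _ _ _ (transition d c) (transition c d) (cmap c x) u d2
   (diff_derivable d1).
rewrite -(deriveE _ d2) (deriveE _ d1) in e; rewrite -e.
rewrite -[RHS](derive_id (cmap c x)); apply: near_eq_derive.
have := open_nbhs_nbhs (conj (@overlap_open c d) (_ : (cmap c @` (cdom c `&` cdom d)) (cmap c x))).
move=> /(_ (ex_intro2 _ _ x (conj cx dx) erefl)).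
apply: filterS => z [y [cy dy] <-] /=.
by rewrite transitionE // transitionE.
Qed.

Definition dtrans_mx c d x : 'M[R]_n := \matrix_(i, j) (dtrans c d x (delta_mx j 0)) i 0.

Lemma dtrans_mxE c d x u : dtrans c d x u = dtrans_mx c d x *m u.
Proof.
rewrite {1}(col_sum_delta u) /dtrans linear_sum; apply/colP => i.
rewrite summxE mxE; apply: eq_bigr => j _.
by rewrite linearZ_LR !mxE mulrC.
Qed.

Lemma dtrans_mxK c d x : cdom c x -> cdom d x -> dtrans_mx d c x *m dtrans_mx c d x = 1%:M.
Proof.
move=> cx dx; apply: mx_eq_mulmx => v.
by rewrite -mulmxA -!dtrans_mxE dtransK // mul1mx.
Qed.

End Manifold.

(** * Frame changes and smoothness of the correction term *)

Section OdotMore.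
Variables (R : realType) (n s t : nat).
Implicit Types (g : 'I_(s + t) -> 'M[R]_n) (Y : 'rV[R]_n) (u v : 'cV[R]_n).
Local Notation spanF g := (<<[seq std_basis g X | X <- enum {set 'I_(s + t)}]>>%VS).

Lemma odot_sum_indep g g' Y u : clifford_gens g -> clifford_gens g' ->
  spanF g = spanF g' -> odot_sum g Y u = odot_sum g' Y u.
Proof.
move=> hg hg' e.
apply: (casimir_indep (be := fun a b : 'M[R]_n =>
  eval_form (Y *m a) u *: b + (a *m u) *m (Y *m b)) hg hg' e).
split=> [a|b] k x y.
  rewrite !mulmxDr -!scalemxAr scalerDr scalerDr !scalerA mulrC -!addrA; congr (_ + _).
  by rewrite addrCA.
rewrite /eval_form !(mulmxDl, mulmxDr) -!(scalemxAl, scalemxAr) !mxE.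
by rewrite scalerDl -scalerA !scalerDr -!addrA; congr (_ + _); rewrite addrCA.
Qed.

Lemma odot_sum_linear g Y : linear (odot_sum g Y).
Proof.
move=> k u v; rewrite /odot_sum scaler_sumr -big_split; apply: eq_bigr => X _ /=.
rewrite /eval_form mulmxDr -scalemxAr !mxE mulmxDr -scalemxAr mulmxDl -scalemxAl.
rewrite scalerDl -scalerA [k *: (cl_sign R X *: _)]scalerA mulrC -scalerA -scalerDr.
by congr (_ *: _); rewrite scalerDr addrACA.
Qed.

Lemma odot_sum_sym g Y u v : odot_sum g Y u *m v = odot_sum g Y v *m u.
Proof.
rewrite !odot_sumE; apply: eq_bigr => X _; congr (_ *: _).
by rewrite /odot addrC.
Qed.

Lemma odot_sum_diag g Y u : odot_sum g Y u *m u =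
  (\sum_X (cl_sign R X * (eval_form (Y *m std_basis g X) u *+ 2)) *: std_basis g X) *m u.
Proof.
rewrite odot_sumE mulmx_suml; apply: eq_bigr => X _.
by rewrite /odot -mulr2n -scalemxAl -scalerA scalerMnl.
Qed.

(** The halves of [odot] behave differently: S lies in A, while T commutes with A by the Casimir
    identity. *)
Lemma odot_sum_normalizes g Y u a : clifford_gens g -> a \in spanF g ->
  odot_sum g Y u *m a - a *m odot_sum g Y u \in spanF g.
Proof.
move=> hg aA.
pose S := \sum_X (cl_sign R X * eval_form (Y *m std_basis g X) u) *: std_basis g X.
pose T := \sum_X cl_sign R X *: ((std_basis g X *m u) *m (Y *m std_basis g X)).
have SA : S \in spanF g.
  apply: rpred_sum => X _; apply/rpredZ/memv_span/map_f; exact: mem_enum.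
have -> : odot_sum g Y u = S + T.
  rewrite -big_split; apply: eq_bigr => X _ /=.
  by rewrite scalerDr scalerA.
have TC : T *m a = a *m T.
  have h : bilinear_map (fun x y : 'M[R]_n => (x *m u) *m (Y *m y)).
    split=> [c|c] k x y; first by rewrite !mulmxDr -!scalemxAr.
    by rewrite !mulmxDl -!scalemxAl.
  have e := casimir_span hg aA h; rewrite mulmx_suml mulmx_sumr.
  transitivity (\sum_X cl_sign R X *: ((std_basis g X *m u) *m (Y *m (std_basis g X *m a)))).
    by apply: eq_bigr => X _; rewrite -scalemxAl !mulmxA.
  by rewrite -e; apply: eq_bigr => X _; rewrite -scalemxAr !mulmxA.
rewrite mulmxDl mulmxDr TC opprD addrACA subrr addr0.
by apply: rpredB; apply: span_mul.
Qed.

Lemma std_basis_conj g X (J K : 'M[R]_n) : K *m J = 1%:M ->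
  std_basis (fun i => J *m g i *m K) X = J *m std_basis g X *m K.
Proof.
move=> KJ; have JK : J *m K = 1%:M by exact: mulmx1C.
rewrite /std_basis; elim/big_rec2: _ => [|i a b _ ->]; first by rewrite mulmx1.
change (J *m g i *m K *m (J *m a *m K) = J *m (g i *m a) *m K).
by rewrite !mulmxA -(mulmxA _ K J) KJ mulmx1.
Qed.

Lemma odot_sum_conj g Y u (J K : 'M[R]_n) : K *m J = 1%:M ->
  odot_sum (fun i => J *m g i *m K) Y (J *m u) = J *m odot_sum g (Y *m J) u *m K.
Proof.
move=> KJ; have JK : J *m K = 1%:M by exact: mulmx1C.
rewrite /odot_sum mulmx_sumr mulmx_suml; apply: eq_bigr => X _.
rewrite std_basis_conj // -scalemxAr -scalemxAl; congr (_ *: _).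
rewrite mulmxDr mulmxDl -scalemxAr -scalemxAl; congr (_ + _).
  by rewrite /eval_form !mulmxA -(mulmxA _ K J) KJ mulmx1.
by rewrite !mulmxA -(mulmxA _ K J) KJ mulmx1.
Qed.

Lemma clifford_gens_conj g (J K : 'M[R]_n) : K *m J = 1%:M ->
  clifford_gens g -> clifford_gens (fun i => J *m g i *m K).
Proof.
move=> KJ [h1 h2]; have JK : J *m K = 1%:M by exact: mulmx1C.
have e i j : J *m g i *m K * (J *m g j *m K) = J *m (g i * g j) *m K.
  change (J *m g i *m K *m (J *m g j *m K) = J *m (g i *m g j) *m K).
  by rewrite !mulmxA -(mulmxA _ K J) KJ mulmx1.
split=> [i|i j ij]; rewrite !e.
  by rewrite h1; case: ifP => _; rewrite ?mulmxN ?mulNmx mulmx1 JK.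
by rewrite (h2 i j ij) mulmxN mulNmx.
Qed.

End OdotMore.

Section SmoothIn.
Variables (R : realType) (n : nat) (M : manifold R n).
Implicit Types (c d : chart M) (x : M).

Lemma Ck_on_chart j c (U : set M) (W : normedModType R) (f : M -> W) :
  (forall x, U x -> exists2 V : set M, V x & Ck_on j (cmap c @` V) (f \o cinv c)) ->
  Ck_on j (cmap c @` U) (f \o cinv c).
Proof.
move=> h; apply/Ck_on_pointwise => _ [x Ux <-].
have [V Vx CV] := h x Ux; apply: Ck_on_sub CV => _ ->; by exists x.
Qed.

Lemma Ck_on_std_basis s t j c (W : set M) (g : 'I_(s + t) -> M -> 'M[R]_n) X :
  open (cmap c @` W) -> (forall i, smooth_in c W (g i)) ->
  Ck_on j (cmap c @` W) (fun z => std_basis (g^~ (cinv c z)) X).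
Proof.
move=> oW sg.
have : forall r : seq 'I_(s + t),
    Ck_on j (cmap c @` W) (fun z => \prod_(i <- r | i \in X) g i (cinv c z)).
  elim=> [|i r IH].
    apply: (@Ck_on_eq _ _ _ _ _ (fun=> 1%:M)) => //; last exact: Ck_on_cst.
    by move=> z _; rewrite big_nil.
  case iX: (i \in X); last first.
    by apply: Ck_on_eq IH => // z _; rewrite big_cons iX.
  apply: (@Ck_on_eq _ _ _ _ _
    (fun z => g i (cinv c z) *m \prod_(l <- r | l \in X) g l (cinv c z))) => //.
    by move=> z _; rewrite big_cons iX.
  by apply: Ck_on_mul => //; exact: (sg i j).
exact.
Qed.

Lemma Ck_on_odot_sum s t j c (W : set M) (g : 'I_(s + t) -> M -> 'M[R]_n)
    (Y : M -> 'rV[R]_n) u :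
  open (cmap c @` W) -> (forall i, smooth_in c W (g i)) -> smooth_in c W Y ->
  Ck_on j (cmap c @` W) (fun z => odot_sum (g^~ (cinv c z)) (Y (cinv c z)) u).
Proof.
move=> oW sg sY; apply: Ck_on_sum => // X _.
have CF := Ck_on_std_basis j X oW sg.
have CY := sY j.
have CYF : Ck_on j (cmap c @` W) (fun z => Y (cinv c z) *m std_basis (g^~ (cinv c z)) X).
  exact: Ck_on_mul.
apply: Ck_onZ => //; first exact: Ck_on_cst.
apply: Ck_onD => //; last first.
  by apply: Ck_on_mul => //; apply: Ck_on_mul => //; exact: Ck_on_cst.
apply: Ck_onZ => //; rewrite /eval_form.
apply: ((Ck_on_mx j (fun z => Y (cinv c z) *m std_basis (g^~ (cinv c z)) X *m u) oW).2).
by apply: Ck_on_mul => //; exact: Ck_on_cst.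
Qed.

End SmoothIn.

(** * The map from one-forms to connections *)

Section Main.
Variables (R : realType) (s t m n : nat) (O : clifford_algebra R s t).
Variables (M : manifold R n) (A : affinor_bundle M) (nabla : connection_field M).
Hypothesis m1 : (1 < m)%N.
Hypothesis hA : A_structure (2 ^ (s + t)) A.
Hypothesis hloc : forall c x, cdom c x ->
  exists (W : set M) (g : 'I_(s + t) -> M -> 'M[R]_n),
    [/\ W x, clifford_frame A c W g &
      forall y, W y ->
        exists theta : {linear 'cV[R]_n -> {ffun 'I_m -> O}},
          bijective theta /\
          forall X v a, theta (std_basis (g ^~ y) X *m v) a
                        = std_basis (@cl_gen R s t O) X * theta v a].
Hypothesis hnabla : connection nabla.
Hypothesis pnabla : preserves A nabla.
Implicit Types (c d : chart M) (x : M) (u v : 'cV[R]_n).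
Local Notation spanF g := (<<[seq std_basis g X | X <- enum {set 'I_(s + t)}]>>%VS).

Definition free_frame (V : {vspace 'M[R]_n}) (g : 'I_(s + t) -> 'M[R]_n) : Prop :=
  [/\ clifford_gens g, V = spanF g &
    exists theta : {linear 'cV[R]_n -> {ffun 'I_m -> O}}, bijective theta /\
      forall X v a, theta (std_basis g X *m v) a =
        std_basis (@cl_gen R s t O) X * theta v a].

Lemma local_free_frame c x : cdom c x -> exists (W : set M) (g : 'I_(s + t) -> M -> 'M[R]_n),
  [/\ W x, clifford_frame A c W g & forall y, W y -> free_frame (A c y) (g^~ y)].
Proof.
move=> cx; have [W [g [Wx fr th]]] := hloc cx.
exists W, g; split=> // y Wy; have [_ _ _ /(_ y Wy) [h1 h2]] := fr.
by split=> //; exact: th.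
Qed.

(* Frames are chosen pointwise, with no regularity: by frame independence the
   smoothness of Phi can be read off the local smooth frames. *)
Definition frame_at c x : 'I_(s + t) -> 'M[R]_n :=
  xget (fun=> 0) [set g | free_frame (A c x) g].

Lemma frame_atP c x : cdom c x -> free_frame (A c x) (frame_at c x).
Proof.
move=> /local_free_frame [W [g [Wx _ /(_ x Wx) h]]].
exact: (@xgetPex _ (fun=> 0) [set g | free_frame (A c x) g] (ex_intro _ _ h)).
Qed.

(** Outside the chart domain the correction is 0, as the convention on components requires. *)
Definition Phi (Y : form_field M) : connection_field M := fun c x u =>
  nabla c x u + (if pselect (cdom c x) then odot_sum (frame_at c x) (Y c x) u else 0).

Lemma PhiE Y c x u (g : 'I_(s + t) -> 'M[R]_n) : cdom c x -> clifford_gens g ->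
  A c x = spanF g -> Phi Y c x u = nabla c x u + odot_sum g (Y c x) u.
Proof.
move=> cx hg e; rewrite /Phi; case: pselect => [? |//]; congr (_ + _).
have [hf ef _] := frame_atP cx.
by apply: odot_sum_indep => //; rewrite -ef.
Qed.

Lemma Phi_frame Y c x u : cdom c x ->
  Phi Y c x u = nabla c x u + odot_sum (frame_at c x) (Y c x) u.
Proof. by move=> cx; have [hf ef _] := frame_atP cx; exact: PhiE. Qed.

(** A change of chart conjugates affinors by its Jacobian, and membership in A does not depend on
    the chart. *)
Lemma frame_conj c d x (J K : 'M[R]_n) : cdom c x -> cdom d x ->
  K *m J = 1%:M -> (forall u, dtrans c d x u = J *m u) ->
  let g := fun i => J *m frame_at c x i *m K in
  clifford_gens g /\ A d x = spanF g.
Proof.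
move=> cx dx K1 E g; have [hf ef _] := frame_atP cx.
have K2 : J *m K = 1%:M by exact: mulmx1C.
split; first exact: clifford_gens_conj.
have [_ _ inv _] := hA.
have mem F : (F \in A c x) = (J *m F *m K \in A d x).
  apply: (inv c d x) => // u.
  by rewrite !E -!mulmxA (mulmxA K) K1 mul1mx.
apply/vspaceP => G.
have -> : G = J *m (K *m G *m J) *m K.
  by rewrite !mulmxA K2 mul1mx -mulmxA K2 mulmx1.
move: (K *m G *m J) => F {G}; rewrite -mem ef.
apply/idP/idP => /memv_spanP [k].
  move=> ->; apply/memv_spanP; exists k; rewrite mulmx_sumr mulmx_suml.
  apply: eq_bigr => X _.
  by rewrite -scalemxAr -scalemxAl std_basis_conj.
move=> e; apply/memv_spanP; exists k.
have -> : F = K *m (J *m F *m K) *m J.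
  by rewrite !mulmxA K1 mul1mx -mulmxA K1 mulmx1.
rewrite e mulmx_sumr mulmx_suml; apply: eq_bigr => X _.
rewrite -scalemxAr -scalemxAl std_basis_conj // !mulmxA K1 mul1mx -mulmxA K1.
by rewrite mulmx1.
Qed.

Lemma Phi_connection Y : one_form Y -> connection (Phi Y).
Proof.
move=> [Y0 Ys Yt]; have [n0 nl ns nt] := hnabla; split.
- by move=> c x u cx; rewrite /Phi n0 //; case: pselect => [//|?]; rewrite addr0.
- move=> c x cx k u v; rewrite !Phi_frame // nl // odot_sum_linear scalerDr.
  by rewrite addrACA.
- move=> c u j; apply: Ck_on_chart => x cx.
  have [W [g [Wx [oW Wc sg fg] _]]] := local_free_frame cx.
  exists W => //; have oI := image_chart_open oW Wc.
  have CN : Ck_on j (cmap c @` W) ((fun x => nabla c x u) \o cinv c).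
    by apply: Ck_on_sub (ns c u j) => _ [y Wy <-]; exists y => //; exact: Wc.
  have sY : smooth_in c W (Y c).
    move=> i; apply: Ck_on_sub (Ys c i) => _ [y Wy <-]; exists y => //; exact: Wc.
  have CO := Ck_on_odot_sum j u oI sg sY.
  apply: Ck_on_eq (Ck_onD oI CN CO) => // _ [y Wy <-] /=.
  have cy := Wc _ Wy; have [h1 h2] := fg y Wy.
  by rewrite (cmapK cy) (PhiE _ _ cy h1 h2).
- move=> c d x u v cx dx.
  rewrite (Phi_frame _ _ cx) mulmxDl.
  have E := @dtrans_mxE R n M c d x; have K1 := dtrans_mxK cx dx.
  move: (dtrans_mx c d x) (dtrans_mx d c x) E K1 => J K E K1.
  (* The law of [nabla] absorbs the second derivatives, so the correction has to be tensorial; by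
     frame independence it may be computed in d with the conjugated frame. *)
  have [h1 h2] := frame_conj cx dx K1 E.
  rewrite (PhiE _ _ dx h1 h2) mulmxDl addrA -nt //.
  rewrite !E mulmxDr; congr (_ + _); rewrite odot_sum_conj //.
  have -> : Y d x *m J = Y c x.
    apply: mx_eq_mulmx => w; rewrite [LHS]mx11_scalar [RHS]mx11_scalar; congr (_%:M).
    by rewrite -mulmxA -E; symmetry; exact: Yt.
  by rewrite -!mulmxA (mulmxA K) K1 mul1mx.
Qed.

Lemma Phi_preserves Y : preserves A (Phi Y).
Proof.
move=> c W F oW Wc sF FA x u Wx; have cx := Wc _ Wx.
have [hf ef _] := frame_atP cx.
have -> : cov_affinor (Phi Y) c F x u = cov_affinor nabla c F x u +
   (odot_sum (frame_at c x) (Y c x) u *m F x - F x *m odot_sum (frame_at c x) (Y c x) u).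
  rewrite /cov_affinor (Phi_frame _ _ cx) mulmxDl mulmxDr.
  move: ('D_u _ _) (nabla c x u *m F x) (F x *m nabla c x u).
  move: (_ *m F x) (F x *m _) => p1 p2 p3 p4 p5.
  by apply/matrixP => i j; rewrite !mxE; ring.
apply: rpredD; first exact: pnabla oW Wc sF FA x u Wx.
by rewrite ef; apply: odot_sum_normalizes => //; rewrite -ef; exact: FA.
Qed.

Lemma Phi_torsion Y c x u v : cdom c x -> torsion (Phi Y) c x u v = torsion nabla c x u v.
Proof.
move=> cx; rewrite /torsion !(Phi_frame _ _ cx) !mulmxDl odot_sum_sym opprD addrACA.
by rewrite subrr addr0.
Qed.

Lemma A_spanD c x u w1 w2 : A_span A c x u w1 -> A_span A c x u w2 -> A_span A c x u (w1 + w2).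
Proof.
move=> [F1 h1 <-] [F2 h2 <-]; exists (F1 + F2); first exact: rpredD.
by rewrite mulmxDl.
Qed.

Lemma A_spanN c x u w : A_span A c x u w -> A_span A c x u (- w).
Proof.
move=> [F h <-]; exists (- F); first by rewrite /= rpredN.
by rewrite mulNmx.
Qed.

Lemma odot_sum_span Y c x u : cdom c x ->
  A_span A c x u (odot_sum (frame_at c x) Y u *m u).
Proof.
move=> cx; have [hf ef _] := frame_atP cx; rewrite odot_sum_diag.
eexists; last by [].
rewrite /= ef; apply: rpred_sum => X _; apply/rpredZ/memv_span/map_f; exact: mem_enum.
Qed.

Lemma Phi_planar Y gam : A_planar A (Phi Y) gam <-> A_planar A nabla gam.
Proof.
split=> -[sm h]; split=> // c r cx q; have := h c r cx; cbv zeta; rewrite -/q.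
  rewrite (Phi_frame _ _ cx) mulmxDl => h1.
  have := A_spanD h1 (A_spanN (odot_sum_span (Y c (gam r)) (q^`()%classic r) cx)).
  by rewrite addrA addrK.
move=> h1; rewrite (Phi_frame _ _ cx) mulmxDl addrA.
exact: A_spanD h1 (odot_sum_span _ _ cx).
Qed.

Definition trace_factor : R := n%:R + (2 ^ (s + t))%:R.

Lemma trace_factor_neq0 : trace_factor != 0.
Proof. by rewrite /trace_factor -natrD pnatr_eq0 addn_eq0 expn_eq0 andbF. Qed.

Lemma trace_frame Y c x u : cdom c x ->
  \tr (odot_sum (frame_at c x) Y u) = trace_factor * eval_form Y u.
Proof.
by move=> cx; have [hf _ [th [bth thF]]] := frame_atP cx; exact: (trace_odot_sum hf bth thF).
Qed.

Lemma eval_form_inj (Y Y' : 'rV[R]_n) : (forall u, eval_form Y u = eval_form Y' u) -> Y = Y'.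
Proof.
move=> h; apply: mx_eq_mulmx => w; rewrite [LHS]mx11_scalar [RHS]mx11_scalar.
by congr (_%:M); exact: h.
Qed.

Lemma Phi_inj Y Y' : one_form Y -> one_form Y' -> Phi Y = Phi Y' -> Y = Y'.
Proof.
move=> [h0 _ _] [h0' _ _] e; apply/funext => c; apply/funext => x.
have [cx|ncx] := pselect (cdom c x); last by rewrite h0 // h0'.
apply: eval_form_inj => u; apply: (mulfI trace_factor_neq0).
rewrite -!(trace_frame _ _ cx); congr (\tr _).
have := congr1 (fun P : connection_field M => P c x u) e.
by rewrite /= !Phi_frame // => /addrI.
Qed.

(** * Surjectivity *)

Section Surjectivity.
Variable om : connection_field M.
Hypothesis hom : connection om.
Hypothesis pom : preserves A om.
Hypothesis tom : forall c x u v, cdom c x -> torsion om c x u v = torsion nabla c x u v.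
Hypothesis plom : forall gam : R -> M, A_planar A om gam <-> A_planar A nabla gam.

Definition conn_diff c x u : 'M[R]_n := om c x u - nabla c x u.

Lemma conn_diff_linear c x : cdom c x -> linear (conn_diff c x).
Proof.
move=> cx k u v; rewrite /conn_diff.
have [_ l1 _ _] := hom; have [_ l2 _ _] := hnabla.
by rewrite l1 // l2 // opprD addrACA -scalerBr.
Qed.

Lemma conn_diff_sym c x u v : cdom c x -> conn_diff c x u *m v = conn_diff c x v *m u.
Proof.
move=> cx; have := tom u v cx; rewrite /torsion /conn_diff !mulmxBl.
move=> e; apply/matrixP => i j; have := congr1 (fun N : 'cV[R]_n => N i j) e.
by rewrite !mxE; lra.
Qed.

(** Extending a with constant coefficients in a smooth frame gives a local section of A; its
    derivative cancels between the two covariant derivatives and the commutator remains. *)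
Lemma conn_diff_normalizes c x u a : cdom c x -> a \in A c x ->
  conn_diff c x u *m a - a *m conn_diff c x u \in A c x.
Proof.
move=> cx; have [W [g [Wx [oW Wc sg _] hm]]] := local_free_frame cx.
have [_ e _] := hm x Wx; rewrite e => /memv_spanP [k ->].
pose F y := \sum_X k X *: std_basis (g^~ y) X.
have sF : smooth_in c W F.
  have oI := image_chart_open oW Wc.
  move=> j; apply: Ck_on_sum => // X _; apply: Ck_onZ => //; first exact: Ck_on_cst.
  exact: Ck_on_std_basis.
have FA y : W y -> F y \in A c y.
  move=> Wy; have [_ -> _] := hm y Wy.
  by apply: rpred_sum => X _; apply/rpredZ/memv_span/map_f; exact: mem_enum.
have h1 := pom oW Wc sF FA u Wx; have h2 := pnabla oW Wc sF FA u Wx.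
rewrite -e -/(F x).
have -> : conn_diff c x u *m F x - F x *m conn_diff c x u =
    cov_affinor om c F x u - cov_affinor nabla c F x u.
  rewrite /conn_diff /cov_affinor mulmxBl mulmxBr.
  move: ('D_u _ _) (om c x u *m F x) (F x *m om c x u) (nabla c x u *m F x) (F x *m nabla c x u).
  by move=> p1 p2 p3 p4 p5; apply/matrixP => i j; rewrite !mxE; ring.
exact: rpredB.
Qed.

Lemma one_mem c x (l : R) : cdom c x -> l *: 1%:M \in A c x.
Proof. by move=> cx; have [_ h _ _] := hA; apply: rpredZ; exact: h. Qed.

Lemma geodesic_curve c x u : cdom c x -> exists (gam : R -> M) (a : R),
  [/\ A_planar A nabla gam, gam 0 = x, a != 0 &
    exists q : R -> 'cV[R]_n, [/\ cmap c \o gam = q, 'D_1 q 0 = a *: u &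
      exists l : R, 'D_1 ('D_1 q) 0 + nabla c x ('D_1 q 0) *m 'D_1 q 0 = l *: 'D_1 q 0]].
Proof.
move=> cx; have [_ l2 s2 t2] := hnabla.
have oU := @cimage_open _ _ M c.
have Ux : (cmap c @` cdom c) (cmap c x) by exists x.
pose Gam p := nabla c (cinv c p).
have lG p : (cmap c @` cdom c) p -> linear (Gam p).
  by move=> [y cy <-]; rewrite /Gam cmapK //; exact: l2.
have [q [a [Cq qU q0 [a0 Dq0] acc]]] := exists_geodesic u oU Ux lG (s2 c).
pose gam r := cinv c (q r).
have gamE r : cdom c (gam r) /\ cmap c (gam r) = q r.
  by have [y cy e] := qU r; rewrite /gam -e cmapK.
have gam0 : gam 0 = x by rewrite /gam q0 cmapK.
have gamC : continuous gam.
  move=> r; apply: (@continuous_comp _ _ _ q (cinv c)).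
    exact: (Ck_on_cont (Cq 0%N) (I : setT r)).
  exact: cinv_continuous (qU r).
have [xx [_ cxx]] := coordinates_cV R n.
have oI d : open (gam @^-1` cdom d).
  by apply: open_comp => [r _|]; [exact: gamC|exact: cdom_open].
have mapI d r : (gam @^-1` cdom d) r -> (cmap c @` (cdom c `&` cdom d)) (q r).
  by move=> dr; exists (gam r); [split=> //; exact: (gamE r).1|exact: (gamE r).2].
have CI d j : Ck_on j (gam @^-1` cdom d) q by apply: Ck_on_sub (Cq j).
exists gam, a; split=> //; last first.
  exists q; split=> //; first by apply/funext => r; exact: (gamE r).2.
  by have [l hl] := acc 0; exists l; move: hl; rewrite /Gam q0 cmapK.
split.
  split=> // d j.
  exact: (Ck_on_comp cxx (oI d) (@overlap_open _ _ M c d) (mapI d) (CI d j)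
    (@transition_smooth _ _ M c d j)).
move=> d r dr q'; rewrite /q' {q'}.
have [D1 D2] := derive2_comp (oI d) (@overlap_open _ _ M c d) dr (mapI d) (CI d 2%N)
   (@transition_smooth _ _ M c d 2%N).
have [cr er] := gamE r.
set w := 'D_1 q r in D1 D2.
have dtE v : 'D_v (transition c d) (q r) = dtrans c d (gam r) v.
  by rewrite /dtrans -er deriveE //; exact: transition_diff.
have e1 : (cmap d \o gam)^`()%classic r = dtrans c d (gam r) w.
  by rewrite derive1E -dtE; exact: D1.
have e2 : (cmap d \o gam)^`(2)%classic r =
    dtrans c d (gam r) ('D_1 ('D_1 q) r) + 'D_w ('D_w (transition c d)) (q r).
  rewrite /= derive1E -dtE -[RHS]D2; congr ('D_1 _ r).
  by apply/funext => r'; rewrite derive1E.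
(* The second-derivative term of [e2] is the inhomogeneous term of the transformation law, so the
   covariant acceleration in d is the image of the one in c. *)
rewrite e1 e2 -er -addrA -(t2 c d (gam r) w w cr dr).
have [l hl] := acc r; rewrite -/w in hl.
exists (l *: 1%:M); first exact: one_mem.
rewrite -scalemxAl mul1mx /dtrans -linearD -linearZ_LR; congr ('d _ _ _).
by rewrite -hl.
Qed.

Lemma conn_diff_planar c x u : cdom c x ->
  exists2 a, a \in A c x & conn_diff c x u *m u = a *m u.
Proof.
move=> cx; have [gam [a [pg g0 a0 [q [qE Dq [l hl]]]]]] := geodesic_curve u cx.
have [_ /(_ c 0)] := (plom gam).2 pg.
rewrite g0 => /(_ cx); cbv zeta; rewrite qE.
have e1 : q^`()%classic = 'D_1 q by apply/funext => r; rewrite derive1E.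
have e2 : q^`(2)%classic 0 = 'D_1 ('D_1 q) 0 by rewrite /= derive1E e1.
rewrite e1 e2 => h1.
have h2 : A_span A c x ('D_1 q 0) (l *: 'D_1 q 0).
  by exists (l *: 1%:M); [exact: one_mem|rewrite -scalemxAl mul1mx].
have := A_spanD h1 (A_spanN h2); rewrite -hl opprD addrACA subrr add0r -mulmxBl.
rewrite -/(conn_diff c x ('D_1 q 0)) Dq => -[F FA].
pose L := HB.pack_for {linear 'cV[R]_n -> 'M[R]_n} (conn_diff c x)
  (GRing.isLinear.Build _ _ _ _ _ (conn_diff_linear cx)).
have -> : conn_diff c x (a *: u) = a *: conn_diff c x u by exact: (linearZ_LR L).
move: (conn_diff c x u) => D; rewrite -!scalemxAl -!scalemxAr => /(scalerI a0) e.
have {}FA : F \in A c x by exact: FA.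
(* At the velocity a u one side is quadratic in a and the other linear; the factor a left over is
   absorbed in F. *)
exists (a^-1 *: F); first by apply: rpredZ.
by rewrite -scalemxAl e scalerA (mulVf a0) scale1r.
Qed.

(** The pointwise argument yields Upsilon without any regularity. The trace formula recovers it from
    the two connections and so transmits their smoothness and transformation law. *)
Definition diff_form : form_field M := fun c x =>
  \row_j (trace_factor^-1 * \tr (conn_diff c x (delta_mx j 0))).

Lemma diff_formE c x u : cdom c x ->
  eval_form (diff_form c x) u = trace_factor^-1 * \tr (conn_diff c x u).
Proof.
move=> cx.
pose L := HB.pack_for {linear 'cV[R]_n -> 'M[R]_n} (conn_diff c x)
  (GRing.isLinear.Build _ _ _ _ _ (conn_diff_linear cx)).
rewrite -[conn_diff c x u]/(L u) {2}(col_sum_delta u) !linear_sum mulr_sumr /eval_form mxE.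
apply: eq_bigr => j _; rewrite mxE (linearZ_LR L) linearZ /=.
by rewrite mulrCA mulrC.
Qed.

Lemma conn_diff_form c x u : cdom c x ->
  conn_diff c x u = odot_sum (frame_at c x) (diff_form c x) u.
Proof.
move=> cx; have [hf ef [th [bth thF]]] := frame_atP cx.
pose L := HB.pack_for {linear 'cV[R]_n -> 'M[R]_n} (conn_diff c x)
  (GRing.isLinear.Build _ _ _ _ _ (conn_diff_linear cx)).
have [||w a|Y hY] := pointwise_form hf bth thF m1 (P := L).
- by move=> w v; exact: conn_diff_sym.
- by move=> w; rewrite -ef; exact: conn_diff_planar.
- by rewrite -ef; exact: conn_diff_normalizes.
suff -> : diff_form c x = Y by exact: hY.
apply: eval_form_inj => w; rewrite diff_formE // -[conn_diff c x w]/(L w) hY.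
by rewrite trace_frame // mulrA mulVf ?mul1r ?trace_factor_neq0.
Qed.

Lemma diff_form_one_form : one_form diff_form.
Proof.
have [b0 _ bs bt] := hom; have [n0 _ ns nt] := hnabla; split.
- move=> c x ncx; apply/rowP => j; rewrite !mxE /conn_diff b0 // n0 // subrr.
  by rewrite mxtrace0 mulr0.
- move=> c j; have oU := @cimage_open _ _ M c; apply/(Ck_on_mx _ _ oU) => i k.
  apply: (@Ck_on_eq _ _ _ _ _ (fun z => trace_factor^-1 *
     \sum_l ((om c (cinv c z) (delta_mx k 0)) l l +
             (-1) * (nabla c (cinv c z) (delta_mx k 0)) l l))) => //.
    move=> z _; rewrite /= mxE; congr (_ * _); apply: eq_bigr => l _.
    by rewrite !mxE mulN1r.
  apply: Ck_onM => //; first exact: Ck_on_cst.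
  apply: Ck_on_sum => // l _; apply: Ck_onD => //.
    exact: ((Ck_on_mx j _ oU).2 (bs c (delta_mx k 0) j)).
  apply: Ck_onM => //; first exact: Ck_on_cst.
  exact: ((Ck_on_mx j _ oU).2 (ns c (delta_mx k 0) j)).
- move=> c d x u cx dx; rewrite !diff_formE //; congr (_ * _).
  have E := @dtrans_mxE R n M c d x; have K1 := dtrans_mxK cx dx.
  move: (dtrans_mx c d x) (dtrans_mx d c x) E K1 => J K E K1.
  have JK : J *m K = 1%:M by exact: mulmx1C.
  (* Both connections have the same inhomogeneous term, which cancels; the difference is conjugated
     by J and its trace is invariant. *)
  have h : J *m conn_diff c x u = conn_diff d x (J *m u) *m J.
    apply: mx_eq_mulmx => v; rewrite -!mulmxA /conn_diff !mulmxBl mulmxBr -!E.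
    by rewrite bt // nt // opprD addrACA subrr add0r.
  rewrite E; have -> : conn_diff d x (J *m u) = J *m conn_diff c x u *m K.
    by rewrite h -mulmxA JK mulmx1.
  by rewrite -[in RHS]mulmxA mxtrace_mulC -mulmxA K1 mulmx1.
Qed.

Lemma Phi_diff_form : Phi diff_form = om.
Proof.
apply/funext => c; apply/funext => x; apply/funext => u.
have [cx|ncx] := pselect (cdom c x).
  by rewrite Phi_frame // -conn_diff_form // /conn_diff addrC subrK.
have [b0 _ _ _] := hom; have [h0 _ _ _] := Phi_connection diff_form_one_form.
by rewrite b0 // h0.
Qed.

End Surjectivity.

End Main.

Theorem theorem3p4 (R : realType) (s t : nat) (O : clifford_algebra R s t) :
  exists eps : {set 'I_(s + t)} -> R,
    (forall X, eps X = 1 \/ eps X = -1) /\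
    forall (m : nat) (M : manifold R (2 ^ (s + t) * m)) (A : affinor_bundle M)
      (nabla : connection_field M),
      (2 * (s + t) <= 2 ^ (s + t) * m)%N ->
      almost_cliffordian O A ->
      connection nabla ->
      preserves A nabla ->
      exists Phi : form_field M -> connection_field M,
        (forall Upsilon, one_form Upsilon ->
         forall (c : chart M) (W : set M)
           (g : 'I_(s + t) -> M -> 'M[R]_(2 ^ (s + t) * m)),
           clifford_frame A c W g ->
           forall x u v, W x ->
             Phi Upsilon c x u *m v
             = nabla c x u *m v
               + \sum_(X : {set 'I_(s + t)})
                   eps X *: odot (Upsilon c x *m std_basis (g ^~ x) X)
                                 (std_basis (g ^~ x) X) u v) /\
        set_bij (@one_form R (2 ^ (s + t) * m) M) (planar_class A nabla) Phi.
Proof.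
exists (@cl_sign R s t); split; first exact: cl_sign_pm.
move=> m M A nabla _ [hA hloc] hn pn.
have m1 : (1 < m)%N.
  by have [h _ _ _] := hA; move: h; rewrite -{1}[(2 ^ _)%N]muln1 ltn_pmul2l // expn_gt0.
exists (Phi m O A nabla); split.
  move=> Y _ c W g [_ Wc _ gW] x u v Wx; have [hg e] := gW x Wx.
  by rewrite (PhiE nabla hloc Y u (Wc _ Wx) hg e) mulmxDl odot_sumE.
split.
- move=> Y hY; split.
  + exact: (Phi_connection hA hloc hn hY).
  + exact: (Phi_preserves hloc pn Y).
  + by move=> c x u v; exact: (Phi_torsion nabla hloc).
  + exact: (Phi_planar nabla hloc).
- move=> Y Y' /set_mem hY /set_mem hY'; exact: (Phi_inj hloc hY hY').
- move=> om [hom pom tom plom]; exists (diff_form s t nabla om).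
    exact: (diff_form_one_form s t hn hom).
  exact: (Phi_diff_form m1 hA hloc hn pn hom pom tom plom).
Qed.
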